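(* Let $\Xi=[-1,0]\times\mathbb{R}$, and let $\ell:\Xi\times[0,T]\to\mathbb{R}$ and $g:\Xi\to\mathbb{R}$ be continuous and bounded from below. Assume that for all $t\in[0,T]$ and $v>0$, $\ell(0,v,t)\ge\ell(0,0,t)$ and $\ell(-1,-v,t)\ge\ell(-1,0,t)$. Then the graph of the multivalued map $\Gamma^{\rm opt}:\Xi^{\rm ad}\to\Gamma$, $(x,v)\mapsto\Gamma^{\rm opt}[x,v]$, is closed in the following sense: let $(x^i,v^i)_{i\in\mathbb{N}}$ be a sequence in $\Xi^{\rm ad}$ with $\lim_{i\to\infty}(x^i,v^i)=(x,v)\in\Xi^{\rm ad}$, and let $(\xi^i,\eta^i)\in\Gamma^{\rm opt}[x^i,v^i]$ for all $i\in\mathbb{N}$; if $(\xi^i,\eta^i)$ tends to $(\xi,\eta)$ uniformly on $[0,T]$, then $(\xi,\eta)\in\Gamma^{\rm opt}[x,v]$.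
   Context: Fix $T>0$. $\Xi^{\rm ad}=\Xi\setminus\big(\{0\}\times(0,+\infty)\cup\{-1\}\times(-\infty,0)\big)$. $\Gamma$ is the set of pairs $(\xi,\eta)\in C^1([0,T];\mathbb{R})\times AC([0,T];\mathbb{R})$ ($AC$ = absolutely continuous) with $\xi'(s)=\eta(s)$ and $(\xi(s),\eta(s))\in\Xi$ for all $s\in[0,T]$. $\Gamma[x,v]=\{(\xi,\eta)\in\Gamma:\xi(0)=x,\eta(0)=v\}$. $$J(\xi,\eta,\eta')=\int_0^T\Big(\ell(\xi(s),\eta(s),s)+\tfrac12|\eta'(s)|^2\Big)ds+g(\xi(T),\eta(T))$$ (equal to $+\infty$ if $\eta'\notin L^2$), and $\Gamma^{\rm opt}[x,v]=\mathrm{argmin}_{(\xi,\eta)\in\Gamma[x,v]}J(\xi,\eta,\eta')$. *)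

(* Defs.v *)
From HB Require Import structures.
From mathcomp Require Import all_boot all_order all_algebra.
From mathcomp Require Import all_classical all_reals all_analysis.

Set Implicit Arguments.
Unset Strict Implicit.
Unset Printing Implicit Defensive.

Import Order.TTheory GRing.Theory Num.Theory.
Import numFieldNormedType.Exports.

Local Open Scope classical_set_scope.
Local Open Scope ring_scope.

(* Functions with domain [0, T] (resp. Xi, Xi x [0, T]) are represented by
   total functions; every notion below depends only on their values on that
   domain. *)

(* One-sided at the endpoints of A when A is a closed interval. *)
Definition derive_within (R : realType) (A : set R) (f : R -> R) (t d : R) :
    Prop :=
  (f s - f t) / (s - t) @[s --> within A t^'] --> d.

Definition C1_on (R : realType) (A : set R) (f : R -> R) : Prop :=
  exists2 f' : R -> R,
    {within A, continuous f'} & forall t, A t -> derive_within A f t (f' t).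

Definition abs_continuous (R : realType) (a b : R) (f : R -> R) : Prop :=
  forall e : R, 0 < e -> exists2 d : R, 0 < d &
    forall (n : nat) (l r : 'I_n -> R),
      (forall i, a <= l i /\ l i <= r i /\ r i <= b) ->
      trivIset setT (fun i => `]l i, r i[%classic) ->
      \sum_(i < n) (r i - l i) < d ->
      \sum_(i < n) `|f (r i) - f (l i)| < e.

Definition Xi (R : realType) : set (R * R) := `[-1, 0]%classic `*` setT.
Arguments Xi : clear implicits.

Definition Xi_ad (R : realType) : set (R * R) :=
  Xi R `\` ([set 0] `*` `]0, +oo[%classic `|` [set -1] `*` `]-oo, 0[%classic).
Arguments Xi_ad : clear implicits.

Definition Gamma (R : realType) (T : R) : set ((R -> R) * (R -> R)) :=
  [set c | [/\ C1_on `[0, T] c.1, abs_continuous 0 T c.2 &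
    forall s, s \in `[0, T] ->
      derive_within `[0, T] c.1 s (c.2 s) /\ Xi R (c.1 s, c.2 s)]].

Definition Gamma_from (R : realType) (T : R) (z : R * R) :
    set ((R -> R) * (R -> R)) :=
  [set c | [/\ Gamma T c, c.1 0 = z.1 & c.2 0 = z.2]].

Definition in_L2 (R : realType) (T : R) (alpha : R -> R) : Prop :=
  measurable_fun `[0, T]%classic alpha /\
  (@lebesgue_measure R).-integrable `[0, T] (fun s => (`|alpha s| ^+ 2)%:E).

Definition J (R : realType) (T : R) (ell : R * R * R -> R) (g : R * R -> R)
    (xi eta alpha : R -> R) : \bar R :=
  if `[< in_L2 T alpha >] then
    (\int[@lebesgue_measure R]_(s in `[0%R, T])
        (ell (xi s, eta s, s) + 2^-1 * `|alpha s| ^+ 2)%:E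
      + (g (xi T, eta T))%:E)%E
  else +oo%E.

(* An absolutely continuous eta is differentiable almost everywhere on [0, T];
   where it is not, derive1 eta takes a fixed default value, which changes neither
   the integral nor, eta being continuous, Borel measurability on ]0, T[. *)
Definition cost (R : realType) (T : R) (ell : R * R * R -> R) (g : R * R -> R)
    (c : (R -> R) * (R -> R)) : \bar R :=
  J T ell g c.1 c.2 (derive1 c.2).

Definition Gamma_opt (R : realType) (T : R) (ell : R * R * R -> R)
    (g : R * R -> R) (z : R * R) : set ((R -> R) * (R -> R)) :=
  [set c | Gamma_from T z c /\
    forall c', Gamma_from T z c' -> (cost T ell g c <= cost T ell g c')%E].

(* Main.v *)
(** A competitor [c] for the limit datum [(x, v)] is turned into competitors [c_i]
    for [(x_i, v_i)] that converge uniformly to [c], so that the [ell] and [g]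
    parts of the cost pass to the limit, and only the energy
    [E = \int eta'^2] has to be controlled.

    Unless [v = 0] and [x] is an endpoint towards which [v_i] points, [c_i] is a
    convex combination of [c] and of a curve which brakes, with a small weight on
    the latter, and [E c_i] is at most [E c + o(1)].  In the remaining case
    [v_i^3] may fail to be small against the distance [|x - x_i|] and the energy
    needed for stopping may blow up.  But then the stopping time
    [th_i = 3 (x - x_i) / v_i] tends to [0], and the curve with velocity
    [v_i (1 - s / th_i)^2] stops exactly at [x] at the time [th_i], with the
    energy [K_i = 4 v_i^2 / (3 th_i)], which is the least energy of an admissible
    curve on [[0, th_i]].  Following [c] after the time [th_i] yields
    [E c_i <= E c + K_i], and comparison with the optimal curve cancels [K_i]: the
    energy of [eta_i] on [[th_i, T]] is bounded by the expected quantity.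

    The limit [i -> \infty] is taken with F. Riesz's criterion: [eta] is absolutely
    continuous with [\int eta'^2 <= C] if and only if
    [\sum_j (eta(r_j) - eta(l_j))^2 / (r_j - l_j) <= C] for all finite families of
    disjoint intervals, a condition which is stable under pointwise limits.  The
    criterion relies on Lebesgue's theorem for absolutely continuous functions,
    obtained from the Radon-Nikodym derivatives of the Stieltjes measures of
    two monotone absolutely continuous functions whose difference is [eta]. *)

Require Import Defs.
From HB Require Import structures.
From mathcomp Require Import all_boot all_order all_algebra finmap.
From mathcomp Require Import all_classical all_reals all_analysis.
From mathcomp Require Import measurable_realfun.
From mathcomp Require Import ring lra.

Set Implicit Arguments.
Unset Strict Implicit.
Unset Printing Implicit Defensive.

Import Order.TTheory GRing.Theory Num.Theory.
Import numFieldNormedType.Exports.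
Local Open Scope classical_set_scope.
Local Open Scope ring_scope.

(** * Total variation of absolutely continuous functions *)

Section absolute_continuity.
Context {R : realType}.
Implicit Types (a b d e : R) (f : R -> R) (s : seq (R * R)).

Definition ordered_in a b (p : R * R) := [&& a <= p.1, p.1 <= p.2 & p.2 <= b].

Definition nonoverlap (p q : R * R) := (p.2 <= q.1) || (q.2 <= p.1).

Lemma nonoverlapC p q : nonoverlap p q = nonoverlap q p.
Proof. exact: orbC. Qed.

Lemma nonoverlap_disjoint p q : nonoverlap p q ->
  `]p.1, p.2[%classic `&` `]q.1, q.2[%classic = set0.
Proof.
move=> pq; apply/seteqP; split=> // y [] /=.
by rewrite !in_itv/= => /andP[? ?] /andP[? ?]; case/orP: pq => ?; lra.
Qed.

(** Lists are convenient for splicing a partition into a family of intervals, and the weak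
    inequality on [e] survives a supremum over partitions. *)
Definition seq_abs_continuous a b f e d := forall s, all (ordered_in a b) s ->
  pairwise nonoverlap s -> \sum_(p <- s) (p.2 - p.1) < d ->
  \sum_(p <- s) `|f p.2 - f p.1| <= e.

Lemma abs_continuous_seq a b f : abs_continuous a b f ->
  forall e, 0 < e -> exists2 d, 0 < d & seq_abs_continuous a b f e d.
Proof.
move=> acf e e0; have [d d0 H] := acf _ e0; exists d => // s sab sdisj sd.
pose l (i : 'I_(size s)) := (nth (0, 0) s i).1.
pose r (i : 'I_(size s)) := (nth (0, 0) s i).2.
have := H _ l r; rewrite !(big_nth (0, 0)) !big_mkord in sd * => /(_ _ _ sd) H'.
apply/ltW/H'.
  move=> i; have /allP/(_ (nth (0, 0) s i)) := sab.
  by rewrite mem_nth// => /(_ isT)/and3P[].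
apply/trivIsetP => i j _ _ ij; apply: nonoverlap_disjoint.
have /(pairwiseP (0, 0)) P := sdisj.
have [ltij|ltji|/val_inj eqij] := ltngtP i j.
- by apply: P; rewrite ?inE.
- by rewrite nonoverlapC; apply: P; rewrite ?inE.
- by rewrite eqij eqxx in ij.
Qed.

Lemma sum_itv_partition a b t : itv_partition a b t ->
  \sum_(p <- zip (a :: t) t) (p.2 - p.1) = b - a.
Proof.
elim: t a => [a /itv_partition_nil ->|x t ih a abt]; first by rewrite big_nil subrr.
rewrite /= big_cons ih; last exact: itv_partition_cons abt.
by rewrite addrC addrA subrK.
Qed.

Lemma ordered_in_itv_partition a b t : itv_partition a b t ->
  all (ordered_in a b) (zip (a :: t) t).
Proof.
elim: t a => // x t ih a abt /=.
have xbt := itv_partition_cons abt.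
have xb := itv_partition_le xbt.
have ax : a < x by case: abt => /= /andP[].
rewrite /ordered_in/= lexx (ltW ax) xb/=.
apply: sub_all (ih _ xbt) => p /and3P[? -> ->].
by rewrite andbT (le_trans (ltW ax)).
Qed.

Lemma nonoverlap_itv_partition a b t : itv_partition a b t ->
  pairwise nonoverlap (zip (a :: t) t).
Proof.
elim: t a => // x t ih a abt.
have xbt := itv_partition_cons abt.
rewrite pairwise_cons ih// andbT.
by apply: sub_all (ordered_in_itv_partition xbt) => p /and3P[? _ _]; apply/orP; left.
Qed.

Lemma variation_itv_partition a b f t : itv_partition a b t ->
  variation a b f t = \sum_(p <- zip (a :: t) t) `|f p.2 - f p.1|.
Proof.
move=> abt; rewrite variation_zip// {abt}.
elim: t a => [a|x t ih a]; first by rewrite !big_nil.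
by rewrite /= !big_cons ih.
Qed.

(* The intervals of [s2] are replaced one by one by partitions, which join [s1]. *)
Lemma sum_total_variation_le a b f e d : seq_abs_continuous a b f e d ->
  forall s2 s1, all (ordered_in a b) (s1 ++ s2) -> pairwise nonoverlap (s1 ++ s2) ->
  \sum_(p <- s1 ++ s2) (p.2 - p.1) < d ->
  ((\sum_(p <- s1) `|f p.2 - f p.1|)%:E
    + \sum_(p <- s2) total_variation p.1 p.2 f <= e%:E)%E.
Proof.
move=> acf; elim=> [s1|p s2 ih s1].
  by rewrite cats0 big_nil adde0 lee_fin; exact: acf.
move=> sab sdisj sd; rewrite big_cons.
have pab : ordered_in a b p by move: sab; rewrite all_cat /= => /and3P[].
have [ap pp pb] := and3P pab.
have S0 : (0 <= \sum_(p <- s2) total_variation p.1 p.2 f)%E.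
  rewrite big_seq; apply: sume_ge0 => q qs2; apply: total_variation_ge0.
  move: sab; rewrite all_cat /= => /and3P[_ _ /allP/(_ _ qs2)].
  by case/and3P.
have H t : itv_partition p.1 p.2 t ->
  ((\sum_(p <- s1) `|f p.2 - f p.1|)%:E + ((variation p.1 p.2 f t)%:E
    + \sum_(p <- s2) total_variation p.1 p.2 f) <= e%:E)%E.
  move=> pt; rewrite addeA -EFinD variation_itv_partition// -big_cat/=.
  have tp := ordered_in_itv_partition pt.
  apply: ih.
  - move: sab; rewrite !all_cat /= => /and3P[-> _ ->]; rewrite andbT/=.
    apply: sub_all tp => q /and3P[? ? ?]; apply/and3P; split; lra.
  - move: sdisj; rewrite -catA !pairwise_cat pairwise_cons allrel_consr allrel_catr.
    move=> /and3P[/andP[s1p s1s2] -> /andP[ps2 ->]].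
    rewrite s1s2 (nonoverlap_itv_partition pt) !andbT/=.
    have sub q q' : ordered_in p.1 p.2 q -> nonoverlap q' p -> nonoverlap q' q.
      move=> /and3P[? ? ?] /orP[?|?]; apply/orP; [left|right]; lra.
    apply/andP; split; apply/allrelP.
      move=> q q' qs1 /(allP tp) q't; apply: sub q't _.
      by move: s1p => /allP; exact.
    move=> q q' /(allP tp) qt q's2; rewrite nonoverlapC; apply: sub qt _.
    by rewrite nonoverlapC; move/allP : ps2; exact.
  - move: sd; rewrite !big_cat big_cons/= (sum_itv_partition pt); lra.
have [pp1|pp1] := eqVneq p.1 p.2.
  have nl : itv_partition p.1 p.2 [::] by split => //=; rewrite pp1.
  move: (H _ nl).
  by rewrite variation_nil pp1 total_variationxx.
have {}pp : p.1 < p.2 by rewrite lt_neqAle pp1.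
(* Once finite, this sum can be moved to the right-hand side, which leaves the supremum over the
   partitions of [p] alone on the left. *)
have S2 : (\sum_(p <- s2) total_variation p.1 p.2 f)%E \is a fin_num.
  rewrite ge0_fin_numE//.
  move: (H _ (itv_partition1 pp)).
  by case: (\sum_(p <- s2) total_variation p.1 p.2 f)%E => [r| |]//=; rewrite ?ltry.
rewrite addeCA -leeBrDr ?fin_numD ?S2//.
apply: ge_ereal_sup => _ [_ [t pt <-] <-].
by rewrite leeBrDr ?fin_numD ?S2// addeCA H.
Qed.

Lemma abs_continuous_total_variation a b f e d : seq_abs_continuous a b f e d ->
  forall s, all (ordered_in a b) s -> pairwise nonoverlap s ->
  \sum_(p <- s) (p.2 - p.1) < d ->
  (\sum_(p <- s) total_variation p.1 p.2 f <= e%:E)%E.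
Proof.
move=> acf s sab sdisj sd; have := @sum_total_variation_le _ _ _ _ _ acf s [::].
by rewrite big_nil add0e; exact.
Qed.

(** Cut [[a, x]] into pieces shorter than the [d] that belongs to [e = 1]: the variation is at most
    1 on each piece, and it is additive. *)
Lemma abs_continuous_fin_total_variation a b f : abs_continuous a b f ->
  forall x, a <= x <= b -> total_variation a x f \is a fin_num.
Proof.
move=> /abs_continuous_seq/(_ 1 ltr01)[d d0 H] x /andP[ax xb].
have shrt y z : a <= y -> y <= z -> z <= b -> z - y < d ->
    total_variation y z f \is a fin_num.
  move=> ay yz zb zyd; rewrite ge0_fin_numE ?total_variation_ge0//.
  rewrite (@le_lt_trans _ _ 1%:E) ?ltry//.
  have := @abs_continuous_total_variation _ _ _ _ _ H [:: (y, z)].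
  by rewrite !big_seq1/= andbT; apply => //; rewrite /ordered_in/= ay yz zb.
have [n nd] : exists n : nat, (x - a) / n.+1%:R < d.
  exists (Num.truncn ((x - a) / d)); rewrite ltr_pdivrMr// mulrC -ltr_pdivrMr//.
  by rewrite truncnS_gt.
pose h := (x - a) / n.+1%:R.
have h0 : 0 <= h by rewrite divr_ge0// subr_ge0.
have hx : h * n.+1%:R = x - a by rewrite divfK// pnatr_eq0.
suff S k : (k <= n.+1)%N -> total_variation a (a + h * k%:R) f \is a fin_num.
  by have := S n.+1 (leqnn _); rewrite hx addrC subrK.
elim: k => [_|k ih kn]; first by rewrite mulr0 addr0 total_variationxx.
have hk : a + h * k.+1%:R = (a + h * k%:R) + h by rewrite -natr1; lra.
have kx : h * k.+1%:R <= x - a by rewrite -hx ler_wpM2l// ler_nat.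
have hk0 : 0 <= h * k%:R by rewrite mulr_ge0.
rewrite (@total_variationD _ _ _ (a + h * k%:R)).
- by rewrite fin_numD ih ?(ltnW kn)// shrt//; rewrite -/h in nd; lra.
- by lra.
- by lra.
Qed.

End absolute_continuity.

(** * Lebesgue's theorem for absolutely continuous functions *)

Section nondecreasing_density.
Context {R : realType}.
Notation mu := (@lebesgue_measure R).
Implicit Types (a b d e : R).

Lemma stieltjes_itv_oc (F : cumulative R R) a b : a <= b ->
  lebesgue_stieltjes_measure F `]a, b]%classic = (F b - F a)%:E.
Proof.
move=> ab; rewrite /lebesgue_stieltjes_measure /measure_extension.
rewrite measurable_mu_extE/=; last exact: is_ocitv.
by rewrite wlength_itv_bnd.
Qed.

(** A set of the ring is a finite disjoint union of half-open intervals, on which both measures are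
    sums of increments; their endpoints form a family to which absolute continuity applies. *)
Lemma stieltjes_ring_le (F : cumulative R R) a b e d :
  seq_abs_continuous a b F e d ->
  forall A : set (SetRing.type (ocitv_type R)), measurable A ->
  A `<=` `]a, b]%classic -> (mu A < d%:E)%E ->
  (lebesgue_stieltjes_measure F A <= e%:E)%E.
Proof.
move=> acF A mA Aab Ad.
have [B [/finite_fsetP[X BX] B0 Btriv Bm AB]] := SetRing.ring_finite_set mA.
have /choice[p pP] : forall Y : set R, exists q : R * R, Y \in X ->
    q.1 < q.2 /\ Y = `]q.1, q.2]%classic.
  move=> Y; have [YX|_] := boolP (Y \in X); last by exists (0, 0).
  have BY : B Y by rewrite BX.
  have : Y \in B by rewrite inE.
  move=> /Bm/ocitvP[Y0|[q q12 Yq]]; last by exists q.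
  by have := B0 _ BY; rewrite Y0 => -[].
have mY Y : Y \in X -> measurable (Y : set (measurableTypeR R)).
  by move=> /pP[_ ->]; exact: measurable_itv.
have AE : A = \big[setU/set0]_(Y <- X) Y by rewrite AB BX bigcup_fset.
rewrite BX in Btriv.
have measA (nu : {measure set (measurableTypeR R) -> \bar R}) :
    nu A = (\sum_(Y <- X) nu Y)%E.
  by rewrite AE -measure_fbigsetU.
have FX Y : Y \in X ->
    lebesgue_stieltjes_measure F Y = (F (p Y).2 - F (p Y).1)%:E.
  by move=> /pP[p12 YE]; rewrite -(stieltjes_itv_oc _ (ltW p12)) -YE.
have muX Y : Y \in X -> mu Y = ((p Y).2 - (p Y).1)%:E.
  move=> /pP[p12 YE]; transitivity (mu `](p Y).1, (p Y).2]%classic).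
    by rewrite -YE.
  by rewrite lebesgue_measure_itv/= lte_fin p12.
rewrite measA (eq_big_seq _ FX).
move: Ad; rewrite measA (eq_big_seq _ muX).
rewrite !sumEFin lte_fin lee_fin => Ad.
apply: le_trans (acF [seq p Y | Y <- X] _ _ _).
- rewrite big_map; apply: ler_sum => Y _; exact: ler_norm.
- apply/allP => _ /mapP[Y YX ->].
  have [p12 YE] := pP _ YX.
  have YA : Y `<=` A by rewrite AB => y Yy; exists Y => //; rewrite BX.
  have sub : `](p Y).1, (p Y).2]%classic `<=` `]a, b]%classic.
    by rewrite -YE; exact: subset_trans Aab.
  rewrite /ordered_in (ltW p12)/=; apply/andP; split.
    rewrite leNgt; apply/negP => pa.
    pose m := Num.min a (p Y).2.
    have : `]a, b]%classic m.
      apply: sub => /=; rewrite in_itv/= lt_min pa p12/= ge_min lexx orbT//.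
    by rewrite /= in_itv/= lt_min ltxx.
  have : `]a, b]%classic (p Y).2 by apply: sub; rewrite /= in_itv/= p12 lexx.
  by rewrite /= in_itv/= => /andP[].
- rewrite pairwise_map.
  have := fset_uniq X; rewrite uniq_pairwise.
  apply: (@sub_in_pairwise _ (mem X)); last by apply/allP => Y.
  move=> Y Z /= YX ZX YZ.
  have [p12 YE] := pP _ YX; have [q12 ZE] := pP _ ZX.
  rewrite /relpre/= /nonoverlap leNgt -implybE; apply/implyP => pq.
  rewrite leNgt; apply/negP => qp.
  move/eqP: YZ; apply; apply: Btriv => //.
  (* Two overlapping half-open intervals both contain the smaller of their right ends, so that
     disjointness forces them to be equal. *)
  pose m := Num.min (p Y).2 (p Z).2; exists m.
  rewrite YE ZE /=; split; rewrite in_itv/= lt_min ge_min lexx ?orbT ?andbT.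
    by rewrite p12.
  by rewrite pq.
- by rewrite big_map.
Qed.

(** A Lebesgue null set is covered by countably many half-open intervals of total length less than
    [d]. The finite subunions lie in the ring, where the bound [e] holds uniformly, and continuity
    from below carries it over to the whole union. *)
Lemma stieltjes_null (F : cumulative R R) a b :
  (forall e, 0 < e -> exists2 d, 0 < d & seq_abs_continuous a b F e d) ->
  forall A : set (measurableTypeR R), measurable A -> A `<=` `]a, b]%classic ->
  mu A = 0%E -> lebesgue_stieltjes_measure F A = 0%E.
Proof.
move=> acF A mA Aab A0; apply/eqP; rewrite eq_le measure_ge0 andbT.
apply/lee_addgt0Pr => e e0; rewrite add0e.
have [d d0 H] := acF _ e0.
have : (mu A < d%:E)%E by rewrite A0 lte_fin.
rewrite /lebesgue_measure /lebesgue_stieltjes_measure /measure_extension.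
move=> /ereal_inf_lt[_ [M [mM AM] <-] Md].
(* The cover is cut down to []a, b]], where the increments of [F] are controlled. *)
pose N k : set (SetRing.type (ocitv_type R)) := \bigcup_(i < k) (M i `&` `]a, b]%classic).
have mN k : measurable (N k).
  apply: fin_bigcup_measurable; first exact: finite_II.
  move=> i _; apply: SetRing.measurable_subring.
  by apply: ocitvI; [exact: mM|exact: is_ocitv].
have mMI i : measurable (M i `&` `]a, b]%classic : set (measurableTypeR R)).
  by apply: measurableI => //; apply: sub_sigma_algebra; exact: mM.
have mN' k : measurable (N k : set (measurableTypeR R)).
  by apply: bigcup_measurable.
have AN : A `<=` \bigcup_k N k.
  move=> x Ax; have [i _ Mx] := AM _ Ax; exists i.+1 => //; exists i => //=.
  by split => //; exact: Aab.
have Nd k : (mu (N k) < d%:E)%E.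
  apply: le_lt_trans Md.
  apply: (@le_trans _ _ (mu (\bigcup_i M i))).
    apply: le_measure; rewrite ?inE//.
      by apply: bigcup_measurable => i _; apply: sub_sigma_algebra; exact: mM.
    by move=> x [i _ [Mx _]]; exists i.
  apply: le_trans (outer_measure_sigma_subadditive _ _) _.
  apply: lee_nneseries => // i _.
  by rewrite -[leRHS]measurable_mu_extE//; exact: mM.
have NF k : (lebesgue_stieltjes_measure F (N k) <= e%:E)%E.
  apply: (stieltjes_ring_le H) => //.
  by move=> x [i _ []].
apply: (@le_trans _ _ (lebesgue_stieltjes_measure F (\bigcup_k N k))).
  by apply: le_measure; rewrite ?inE//; exact: bigcup_measurable.
have Ncvg : lebesgue_stieltjes_measure F \o N @ \oo -->
    lebesgue_stieltjes_measure F (\bigcup_k N k).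
  apply: nondecreasing_cvg_mu => //; first exact: bigcup_measurable.
  move=> m n mn; apply/subsetPset => x [i im Mi]; exists i => //.
  exact: leq_trans im mn.
rewrite -(cvg_lim _ Ncvg)//; apply: lime_le; first by apply/cvg_ex; eexists; exact: Ncvg.
by near=> k; exact: NF.
Unshelve. all: by end_near. Qed.

(** The density is the Radon-Nikodym derivative of the Stieltjes measure of [F], restricted to []a,
    b]] so that it is finite and dominated by the Lebesgue measure. *)
Lemma nondecreasing_density (F : cumulative R R) a b : a <= b ->
  (forall e, 0 < e -> exists2 d, 0 < d & seq_abs_continuous a b F e d) ->
  exists g : R -> R, [/\ forall x, 0 <= g x,
    mu.-integrable setT (EFin \o g) &
    forall x, a <= x <= b -> F x - F a = \int[mu]_(t in `]a, x]) g t].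
Proof.
move=> ab acF.
have mD : measurable (`]a, b]%classic : set (measurableTypeR R)) by exact: measurable_itv.
have Doo : (lebesgue_stieltjes_measure F `]a, b]%classic < +oo)%E.
  by rewrite stieltjes_itv_oc// ltry.
pose nu : {finite_measure set _ -> \bar R} := mfrestr mD Doo.
have dom : nu `<< mu.
  apply/null_content_dominatesP => A mA A0.
  rewrite /nu /= /mfrestr /mrestr; apply: (stieltjes_null acF).
  - exact: measurableI.
  - exact: subIsetr.
  - apply/eqP; rewrite eq_le measure_ge0 andbT -A0 le_measure ?inE//.
    exact: measurableI.
have [g [g0 gfin gint gE]] := radon_nikodym_sigma_finite dom.
have gfineE : EFin \o (fine \o g) = g by apply/funext => x /=; rewrite fineK.
exists (fine \o g); split.
- by move=> x; rewrite fine_ge0.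
- by rewrite gfineE.
move=> x /andP[ax xb].
have := gE `]a, x]%classic (measurable_itv _).
rewrite /Rintegral /nu /= /mfrestr /mrestr.
rewrite setIidl; last by move=> y /=; rewrite !in_itv/= => /andP[-> /le_trans]; exact.
rewrite stieltjes_itv_oc// => E.
have -> : (\int[mu]_(t in `]a, x]) (fine (g t))%:E)%E = (F x - F a)%:E.
  by rewrite E; apply: eq_integral => t _; rewrite fineK.
by [].
Qed.

End nondecreasing_density.

Section lebesgue_ftc.
Context {R : realType}.
Notation mu := (@lebesgue_measure R).
Implicit Types (a b d e : R).

(** Composition with [clamp a b] extends a function from [[a, b]] to the whole line by its end
    values and preserves continuity and monotonicity. *)
Definition clamp a b x : R := Num.max a (Num.min b x).

Lemma clamp_id a b x : a <= x <= b -> clamp a b x = x.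
Proof. by move=> /andP[ax xb]; rewrite /clamp (min_r xb) (max_r ax). Qed.

Lemma clamp_in a b x : a <= b -> a <= clamp a b x <= b.
Proof. by move=> ab; rewrite /clamp le_max lexx/= ge_max ab ge_min lexx. Qed.

Lemma clamp_nondecreasing a b : {homo clamp a b : x y / x <= y}.
Proof.
move=> x y xy; rewrite /clamp ge_max !le_max lexx/= le_min !ge_min lexx xy.
by rewrite !orbT.
Qed.

Lemma clamp_dist a b x y : x <= y -> clamp a b y - clamp a b x <= y - x.
Proof.
move=> xy; rewrite /clamp /Num.max /Num.min.
by case: (ltP b x) => ?; case: (ltP b y) => ?; do ?[case: ltP => ?]; lra.
Qed.

Lemma seq_abs_continuous_clamp a b (F : R -> R) : a <= b ->
  (forall e, 0 < e -> exists2 d, 0 < d & seq_abs_continuous a b F e d) ->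
  continuous (F \o clamp a b).
Proof.
move=> ab acF x; apply/cvgrPdist_le => e e0.
have [d d0 H] := acF _ e0.
have key y z : y <= z -> z - y < d -> `|F (clamp a b z) - F (clamp a b y)| <= e.
  move=> yz zyd; have := H [:: (clamp a b y, clamp a b z)].
  rewrite !big_seq1/= andbT; apply => //.
    have /andP[? ?] := clamp_in y ab; have /andP[? ?] := clamp_in z ab.
    by apply/and3P; split=> //; exact: clamp_nondecreasing.
  exact: le_lt_trans (clamp_dist _ _ yz) zyd.
near=> y; rewrite /=.
have : `|x - y| < d by near: y; exact: cvgr_dist_lt.
have [xy|/ltW yx] := leP x y.
  by rewrite distrC ger0_norm ?subr_ge0// => ?; rewrite distrC key.
by rewrite ger0_norm ?subr_ge0// => ?; rewrite key.
Unshelve. all: by end_near. Qed.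

(** A Stieltjes measure asks for a monotone right-continuous function on the line; the clamped
    extension of [F] is one. *)
Lemma nondecreasing_itv_density (F : R -> R) a b : a <= b ->
  {in `[a, b] &, {homo F : x y / x <= y}} ->
  (forall e, 0 < e -> exists2 d, 0 < d & seq_abs_continuous a b F e d) ->
  exists g : R -> R, mu.-integrable setT (EFin \o g) /\
    forall x, a <= x <= b -> F x - F a = \int[mu]_(t in `]a, x]) g t.
Proof.
move=> ab ndF acF.
have nd : nondecreasing (F \o clamp a b).
  move=> x y xy; apply: ndF; rewrite ?in_itv/= ?clamp_in//.
  exact: clamp_nondecreasing.
have rc := right_continuousW (seq_abs_continuous_clamp ab acF).
pose G : cumulative R R :=
  HB.pack_for (cumulative R R) (F \o clamp a b) (isCumulative.Build _ _ _ _ nd rc).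
have acG e : 0 < e -> exists2 d, 0 < d & seq_abs_continuous a b G e d.
  move=> /acF[d d0 H]; exists d => // s sab sdisj sd.
  apply: le_trans (H s sab sdisj sd); rewrite !big_seq; apply: ler_sum => p ps.
  have /and3P[? ? ?] := allP sab _ ps.
  rewrite /G/= !clamp_id//; apply/andP; split; lra.
have [g [_ gint gE]] := nondecreasing_density ab acG.
exists g; split => // x axb; rewrite -gE//.
by rewrite /G/= !clamp_id// lexx.
Qed.

(** Jordan decomposition [f = V - (V - f)] with [V] the variation from [a]. Both terms are
    nondecreasing because [|f y - f x| <= V y - V x], and both inherit absolute continuity from the
    bound on total variations. *)
Lemma abs_continuous_density (f : R -> R) a b : a <= b -> abs_continuous a b f ->
  exists g : R -> R, mu.-integrable setT (EFin \o g) /\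
    forall x, a <= x <= b -> f x - f a = \int[mu]_(t in `]a, x]) g t.
Proof.
move=> ab acf; have TVfin := abs_continuous_fin_total_variation acf.
pose V x := fine (total_variation a x f).
have VB x y : a <= x -> x <= y -> y <= b ->
    (V y - V x)%:E = total_variation x y f.
  move=> ax xy yb; rewrite EFinB !fineK ?TVfin ?ax ?(le_trans ax xy)//=.
    by rewrite (total_variationD f ax xy) addeAC subee ?add0e// TVfin// ax (le_trans xy).
  by rewrite (le_trans xy).
have fV x y : a <= x -> x <= y -> y <= b -> `|f y - f x| <= V y - V x.
  by move=> ax xy yb; rewrite -lee_fin VB// total_variation_ge.
have acV e : 0 < e -> exists2 d, 0 < d & forall s, all (ordered_in a b) s ->
    pairwise nonoverlap s -> \sum_(p <- s) (p.2 - p.1) < d ->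
    \sum_(p <- s) (V p.2 - V p.1) <= e.
  move=> e0; have [d d0 H] := abs_continuous_seq acf e0.
  exists d => // s sab sdisj sd; rewrite -lee_fin -sumEFin.
  apply: le_trans (abs_continuous_total_variation H sab sdisj sd).
  rewrite !big_seq; apply: lee_sum => p ps.
  by have /and3P[? ? ?] := allP sab _ ps; rewrite VB.
have ndV : {in `[a, b] &, {homo V : x y / x <= y}}.
  move=> x y; rewrite !in_itv/= => /andP[ax xb] /andP[ay yb] xy.
  by rewrite -subr_ge0 (le_trans _ (fV _ _ ax xy yb)).
have ndW : {in `[a, b] &, {homo (V \- f) : x y / x <= y}}.
  move=> x y; rewrite !in_itv/= => /andP[ax xb] /andP[ay yb] xy.
  by have := fV _ _ ax xy yb; have := ler_norm (f y - f x); lra.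
have [gV [gVint gVE]] : exists g : R -> R, mu.-integrable setT (EFin \o g) /\
    forall x, a <= x <= b -> V x - V a = \int[mu]_(t in `]a, x]) g t.
  apply: nondecreasing_itv_density => // e /acV[d d0 H]; exists d => // s sab sdisj sd.
  apply: le_trans (H s sab sdisj sd); rewrite !big_seq; apply: ler_sum => p ps.
  have /and3P[? ? ?] := allP sab _ ps.
  by rewrite ger0_norm// (le_trans _ (fV _ _ _ _ _)).
have [gW [gWint gWE]] : exists g : R -> R, mu.-integrable setT (EFin \o g) /\
    forall x, a <= x <= b -> (V \- f) x - (V \- f) a = \int[mu]_(t in `]a, x]) g t.
  apply: nondecreasing_itv_density => // e e0.
  (* The increments of [V - f] are at most twice those of [V]. *)
  have [|d d0 H] := acV (e / 2); first by rewrite divr_gt0.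
  exists d => // s sab sdisj sd.
  apply: (@le_trans _ _ (2 * \sum_(p <- s) (V p.2 - V p.1))).
    rewrite mulr_sumr !big_seq; apply: ler_sum => p ps.
    have /and3P[p1 p2 p3] := allP sab _ ps.
    have := fV _ _ p1 p2 p3; rewrite ler_norml => /andP[? ?].
    rewrite ler_norml; apply/andP; split => /=; lra.
  by rewrite mulrC -ler_pdivlMr// H.
exists (gV \- gW); split.
  exact: (integrableB measurableT gVint gWint).
move=> x axb; rewrite RintegralB//; [|exact: integrableS gVint|exact: integrableS gWint].
by rewrite -gVE// -gWE//=; lra.
Qed.

(** Lebesgue differentiation applies to the primitive of [g], with which [f - f a] coincides near
    every interior point. *)
Theorem abs_continuous_FTC (f : R -> R) a b : a <= b -> abs_continuous a b f ->
  exists g : R -> R, [/\ mu.-integrable setT (EFin \o g),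
    forall x, a <= x <= b -> f x - f a = \int[mu]_(t in `]a, x]) g t &
    {ae mu, forall x, a < x < b -> is_derive x 1 f (g x)}].
Proof.
move=> ab acf; have [g [gint gE]] := abs_continuous_density ab acf.
exists g; split => //.
have gint' A : measurable A -> mu.-integrable A (EFin \o g).
  by move=> mA; exact: integrableS gint.
have locg : locally_integrable setT g.
  by have := integrable_locally measurableT gint; rewrite patch_setT.
have := @FTC1 R g (BRight a) (fun y => gint' _ (measurable_itv _)) locg.
apply: filterS; first exact: (ae_filter_ringOfSetsType mu).
move=> x H /andP[ax xb].
have [dF F'] := H ax.
pose F y := \int[mu]_(t in `]a, y]) g t.
have Ff : {near x, F + cst (f a) =1 f}.
  near=> y; rewrite /= /F fctE -gE; first by rewrite subrK.
  have : y \in `]a, b[ by near: y; apply: near_in_itvoo; rewrite in_itv/= ax.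
  by rewrite in_itv/= => /andP[/ltW -> /ltW ->].
apply: (near_eq_is_derive Ff).
rewrite -[g x]addr0; apply: is_deriveD.
by rewrite -F' derive1E; apply: DeriveDef.
Unshelve. all: by end_near. Qed.

End lebesgue_ftc.

(** * Measurability of the pointwise derivative *)

Section measurable_derivative.
Context {R : realType}.
Notation mu := (@lebesgue_measure R).
Implicit Types (a b e : R) (f : R -> R).

Let slope f h x : R := h^-1 *: (f (h + x) - f x).

(* For fixed increments [p.1] and [p.2] the condition on [x] is closed, hence the
   points of differentiability form a countable intersection of F_sigma sets. *)
Let slope_close f m n : set R :=
  \bigcap_(p in [set p : R * R | 0 < `|p.1| < m.+1%:R^-1 /\ 0 < `|p.2| < m.+1%:R^-1])
    [set x | `|slope f p.1 x - slope f p.2 x| <= n.+1%:R^-1].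

Lemma harmonic_cvg_dnbhs : harmonic @ \oo --> (0 : R)^'.
Proof.
move=> A [e /= e0 eA].
have /cvgrPdist_lt/(_ _ e0) := @cvg_harmonic R.
by apply: filterS => n ne; apply: eA => //=.
Qed.

Lemma continuous_slope f h : continuous f -> continuous (slope f h).
Proof.
move=> cf x; apply: cvgZ; first exact: cvg_cst.
apply: cvgB; last exact: cf.
apply: (@cvg_comp _ _ _ (fun y => h + y) f _ (nbhs (h + x))); last exact: cf.
by apply: cvgD; [exact: cvg_cst|exact: cvg_id].
Qed.

(** Cauchy's criterion for the difference quotients; tolerances and radii of the form [n.+1%:R^-1]
    keep the set operations countable. *)
Lemma cvg_slopeP f x : cvg (slope f h x @[h --> (0 : R)^']) <->
  (\bigcap_n \bigcup_m slope_close f m n) x.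
Proof.
split=> [/cvg_cauchy/cauchy_ballP H n _|H].
- have [|[A B]/= [A0 B0] AB] := H n.+1%:R^-1; first by rewrite invr_gt0.
  have [/= d d0 dA] := filterI A0 B0.
  have [m md] : exists m : nat, m.+1%:R^-1 < d.
    exists (Num.truncn d^-1); rewrite -[ltRHS]invrK ltf_pV2 ?posrE ?invr_gt0//.
    by rewrite truncnS_gt.
  exists m => // -[h k]/= [/andP[h0 hm] /andP[k0 km]].
  have [Ah Bh] : (A `&` B) (slope f h x).
    apply: dA; first by rewrite /= sub0r normrN (lt_trans hm).
    by rewrite -normr_gt0.
  have [Ak Bk] : (A `&` B) (slope f k x).
    apply: dA; first by rewrite /= sub0r normrN (lt_trans km).
    by rewrite -normr_gt0.
  by apply/ltW; apply: (AB (_, _)).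
- apply: cauchy_cvg; apply/cauchy_ballP => e e0.
  have [n ne] : exists n : nat, n.+1%:R^-1 < e.
    exists (Num.truncn e^-1); rewrite -[ltRHS]invrK ltf_pV2 ?posrE ?invr_gt0//.
    by rewrite truncnS_gt.
  have [m _ Hm] := H n I.
  pose A := [set slope f h x | h in [set h | 0 < `|h| < m.+1%:R^-1]].
  have nA : (slope f h x @[h --> (0 : R)^']) A.
    exists m.+1%:R^-1 => /=; first by rewrite invr_gt0.
    move=> h /=; rewrite sub0r normrN => hm h0; exists h => //=.
    by rewrite normr_gt0 h0.
  exists (A, A) => //= -[_ _] /= [[h hm <-] [k km <-]].
  by rewrite -ball_normE /= (le_lt_trans _ ne)//; exact: (Hm (h, k)).
Qed.

(** On the set [D] of differentiability, [derive1 f] is the limit of the slopes along the increments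
    [harmonic n]; off [D] it has the constant default value [point]. *)
Lemma measurable_derive1 f : continuous f -> measurable_fun setT (derive1 f).
Proof.
move=> cf; set D := \bigcap_n \bigcup_m slope_close f m n.
have mD : measurable D.
  apply: bigcapT_measurable => n; apply: bigcupT_measurable => m.
  apply: closed_measurable; apply: closed_bigI => -[h k] _ /=.
  rewrite (_ : [set x | _] =
    (fun x => `|slope f h x - slope f k x|) @^-1` [set y | y <= n.+1%:R^-1])//.
  apply: preimage_closed; last exact: closed_le.
  move=> x _; apply: cvg_norm; apply: cvgB; exact: continuous_slope.
rewrite -(setUv D); apply/measurable_funU => //; first exact: measurableC.
split.
  apply: (@measurable_fun_cvg _ _ _ D (fun n => slope f (harmonic n))).
    by move=> n; apply: measurable_funTS; apply: continuous_measurable_fun;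
      exact: continuous_slope.
  move=> x /cvg_slopeP cx.
  apply: (@cvg_comp _ _ _ harmonic (fun h => slope f h x) _ 0^') => //.
  exact: harmonic_cvg_dnbhs.
apply: (@eq_measurable_fun _ _ _ _ _ (cst point)); last exact: measurable_cst.
move=> x; rewrite inE => Dx; rewrite /derive1 /cst; apply/esym/dvgP.
by move=> /cvg_slopeP.
Qed.

(** The clamped extension is continuous on the line and has the same derivative inside []a, b[]; the
    two endpoints do not affect measurability. *)
Lemma abs_continuous_measurable_derive1 f a b : a <= b -> abs_continuous a b f ->
  measurable_fun `[a, b] (derive1 f).
Proof.
move=> ab acf.
have cf : continuous (f \o clamp a b).
  by apply: seq_abs_continuous_clamp => // e; exact: abs_continuous_seq.
apply: (@measurable_fun_itv_cc _ a b false true).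
apply: (@eq_measurable_fun _ _ _ _ _ (derive1 (f \o clamp a b))); last first.
  exact: measurable_funTS (measurable_derive1 cf).
move=> x; rewrite inE/= => xab; rewrite !derive1E; apply: near_eq_derive.
near=> y; rewrite /= clamp_id//.
have : y \in `]a, b[ by near: y; apply: near_in_itvoo.
by rewrite in_itv/= => /andP[/ltW -> /ltW ->].
Unshelve. all: by end_near. Qed.

End measurable_derivative.

(** * Riesz's characterization of finite energy *)

Section increments.
Context {R : realType}.
Notation mu := (@lebesgue_measure R).
Implicit Types (a b C e : R) (f h phi : R -> R).

Lemma abs_continuousS a b c d f : a <= c -> d <= b -> abs_continuous a b f ->
  abs_continuous c d f.
Proof.
move=> ac db acf e e0; have [del del0 H] := acf _ e0; exists del => // n l r lr.
apply: H => i; have [? [? ?]] := lr i; split; [|split] => //; lra.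
Qed.

(** Serves for functions [h] built from [f] and Lipschitz terms, to which [increment_le_integral] is
    then applied. *)
Lemma abs_continuous_le a b f h (A B : R) : 0 <= A -> 0 <= B ->
  (forall x y, a <= x -> x <= y -> y <= b ->
    `|h y - h x| <= A * `|f y - f x| + B * (y - x)) ->
  abs_continuous a b f -> abs_continuous a b h.
Proof.
move=> A0 B0 H acf e e0.
have A1 : 0 < A + 1 by lra.
have B1 : 0 < B + 1 by lra.
have [|d d0 Hd] := acf (e / 2 / (A + 1)); first by rewrite !divr_gt0.
exists (Num.min d (e / 2 / (B + 1))).
  by rewrite lt_min d0 !divr_gt0.
move=> n l r lr tlr; rewrite lt_min => /andP[sd sB].
apply: (@le_lt_trans _ _
    (A * \sum_(i < n) `|f (r i) - f (l i)| + B * \sum_(i < n) (r i - l i))).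
  rewrite !mulr_sumr -big_split/=; apply: ler_sum => i _.
  by have [? [? ?]] := lr i; exact: H.
have /ltW S1 := Hd n l r lr tlr sd.
have S2 := ltW sB.
rewrite ler_pdivlMr// in S1; rewrite ltr_pdivlMr// in sB.
have S10 : 0 <= \sum_(i < n) `|f (r i) - f (l i)| by exact: sumr_ge0.
have S20 : 0 <= \sum_(i < n) (r i - l i).
  by apply: sumr_ge0 => i _; have [? [? ?]] := lr i; rewrite subr_ge0.
nra.
Qed.

Lemma Rintegral_itv_oo_cc a b f : mu.-integrable `[a, b] (EFin \o f) ->
  \int[mu]_(x in `]a, b[) f x = \int[mu]_(x in `[a, b]) f x.
Proof.
move=> fint; rewrite /Rintegral (@integral_itv_bndoo _ a b _ true false)//.
apply: measurable_funS (measurable_int mu fint) => //.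
exact: subset_itv_oo_cc.
Qed.

(** The density of [h] is almost everywhere its derivative, hence at most [phi]. Lower bounds on an
    energy are obtained from it by exhibiting a primitive [h] of a minorant of the squared
    derivative. *)
Lemma increment_le_integral a b h phi : a <= b -> abs_continuous a b h ->
  mu.-integrable `[a, b] (EFin \o phi) ->
  {ae mu, forall x, a < x < b -> exists2 d, is_derive x 1 h d & d <= phi x} ->
  h b - h a <= \int[mu]_(x in `[a, b]) phi x.
Proof.
move=> ab ach phiint dh; have [g [gint gE dg]] := abs_continuous_FTC ab ach.
have gint' (i : interval R) : mu.-integrable [set` i] (EFin \o g).
  by apply: integrableS gint.
rewrite gE; last by rewrite ab lexx.
rewrite Rintegral_itv_obnd_cbnd; last exact: gint'.
rewrite -(Rintegral_itv_oo_cc (gint' `[a, b])).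
rewrite -(Rintegral_itv_oo_cc phiint).
have phiint' : mu.-integrable `]a, b[ (EFin \o phi).
  by apply: integrableS phiint => //; exact: subset_itv_oo_cc.
(* [m] equals [phi] almost everywhere and dominates [g] at every point, as the monotonicity of the
   integral requires. *)
pose m x := Num.max (g x) (phi x).
have mm : measurable_fun `]a, b[ m.
  apply: measurable_maxr; apply/measurable_EFinP.
    exact: measurable_int (gint' _).
  exact: measurable_int phiint'.
have phim : ae_eq mu `]a, b[%classic (EFin \o phi) (EFin \o m).
  apply: filterS2 dh dg; first exact: (ae_filter_ringOfSetsType mu).
  move=> x dhx dgx; rewrite /= in_itv/= => axb; congr EFin.
  have {dhx}[d dhx dphi] := dhx axb; have {}dgx := dgx axb.
  have dE : d = g x by case: dhx => _ <-; case: dgx => _ <-.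
  by rewrite /m max_r// -dE.
have int_m : mu.-integrable `]a, b[ (EFin \o m).
  apply/integrableP; split; first exact/measurable_EFinP.
  have /integrableP[mphi] := phiint'; apply: le_lt_trans.
  rewrite le_eqVlt; apply/orP; left; apply/eqP; apply: ae_eq_integral => //.
  - by apply: measurableT_comp => //; exact/measurable_EFinP.
  - exact: measurableT_comp.
  - by apply: filterS phim => x phimx axb; rewrite -[RHS]/(abse ((EFin \o phi) x)) phimx.
have -> : \int[mu]_(x in `]a, b[) phi x = \int[mu]_(x in `]a, b[) m x.
  congr fine; apply: ae_eq_integral => //; first exact: measurable_int phiint'.
  exact/measurable_EFinP.
apply: le_Rintegral => //.
by move=> x _; rewrite /m le_max lexx.
Qed.

End increments.

Section energy.
Context {R : realType}.
Notation mu := (@lebesgue_measure R).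
Implicit Types (a b C e : R) (f h phi : R -> R).

Definition disjoint_family a b n (l r : 'I_n -> R) :=
  (forall i, a <= l i /\ l i <= r i /\ r i <= b) /\
  trivIset setT (fun i => `]l i, r i[%classic).

(* A degenerate interval contributes 0 / 0 = 0. *)
Definition energy_bound a b f C := forall n (l r : 'I_n -> R),
  disjoint_family a b l r ->
  \sum_(i < n) (f (r i) - f (l i)) ^+ 2 / (r i - l i) <= C.

(** The image intervals []G (l i), G (r i)[] are again disjoint and lie in [[G a, G b]], so that the
    claim compares Lebesgue measures. *)
Lemma disjoint_family_nondecreasing a b (G : R -> R) n (l r : 'I_n -> R) :
  a <= b -> {in `[a, b] &, {homo G : x y / x <= y}} -> disjoint_family a b l r ->
  \sum_(i < n) (G (r i) - G (l i)) <= G b - G a.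
Proof.
move=> ab ndG [lr tlr].
have inab i : [/\ l i \in `[a, b], r i \in `[a, b] & l i <= r i].
  by have [? [? ?]] := lr i; rewrite !in_itv/=; split => //; apply/andP; split; lra.
have [aab bab] : a \in `[a, b] /\ b \in `[a, b] by rewrite !in_itv/= !lexx ab.
have tG : trivIset setT (fun i => `]G (l i), G (r i)[%classic).
  move=> i j _ _ [y [/=]]; rewrite !in_itv/= => /andP[li ri] /andP[lj rj].
  have [lii rii lri] := inab i; have [lij rij lrj] := inab j.
  have lirj : l i < r j.
    rewrite ltNge; apply/negP => /(ndG _ _ rij lii); lra.
  have ljri : l j < r i.
    rewrite ltNge; apply/negP => /(ndG _ _ rii lij); lra.
  have lri' : l i < r i.
    rewrite ltNge; apply/negP => /(ndG _ _ rii lii); lra.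
  have lrj' : l j < r j.
    rewrite ltNge; apply/negP => /(ndG _ _ rij lij); lra.
  apply: tlr => //.
  (* The midpoint of the overlap of the two original intervals. *)
  exists ((Num.max (l i) (l j) + Num.min (r i) (r j)) / 2); split => /=;
    rewrite in_itv/= /Num.max /Num.min; case: (ltP (l i) (l j)) => ?;
    case: (ltP (r i) (r j)) => ?; apply/andP; split; lra.
have mI i : measurable (`]G (l i), G (r i)[%classic : set R) by exact: measurable_itv.
have muI i : mu (`]G (l i), G (r i)[%classic : set R) = (G (r i) - G (l i))%:E.
  rewrite lebesgue_measure_itv/= lte_fin; case: ltP => // H.
  have [li ri lri] := inab i.
  by have := ndG _ _ li ri lri => ?; congr EFin; lra.
have := measure_bigsetU_ord mu xpredT mI tG.
rewrite [X in _ = X](eq_bigr _ (fun i _ => muI i)).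
rewrite sumEFin => S; rewrite -lee_fin -S.
apply: (@le_trans _ _ (mu `[G a, G b])).
  apply: le_measure; rewrite ?inE//; first exact: bigsetU_measurable.
  rewrite -bigcup_seq => y [i _ /=]; rewrite !in_itv/= => /andP[ly yr].
  have [li ri _] := inab i.
  move: (li) (ri); rewrite !in_itv/= => /andP[al _] /andP[_ rb].
  by have := ndG _ _ aab li al; have := ndG _ _ ri bab rb => ? ?; apply/andP; split; lra.
rewrite lebesgue_measure_itv/= lte_fin; case: ltP => // H.
by rewrite lee_fin subr_ge0 ndG.
Qed.

Lemma abs_continuous_is_derive a b f : a <= b -> abs_continuous a b f ->
  {ae mu, forall x, a < x < b -> is_derive x 1 f (derive1 f x)}.
Proof.
move=> ab /(abs_continuous_FTC ab)[g [_ _]].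
apply: filterS; first exact: (ae_filter_ringOfSetsType mu).
by move=> x H /H {}H; rewrite derive1E; apply: DeriveDef; case: H.
Qed.

Lemma increment_energy a b f : a <= b -> abs_continuous a b f ->
  mu.-integrable `[a, b] (EFin \o (fun x => derive1 f x ^+ 2)) ->
  (f b - f a) ^+ 2 / (b - a) <= \int[mu]_(x in `[a, b]) (derive1 f x ^+ 2).
Proof.
move=> ab acf f2; have [<-|ba] := eqVneq a b.
  by rewrite subrr expr0n/= mul0r; apply: Rintegral_ge0 => x _; exact: sqr_ge0.
have {}ba : 0 < b - a by rewrite subr_gt0 lt_neqAle ba.
(* With [c] the mean slope, integrate [2 * c * f' - c ^+ 2 <= f' ^+ 2]. *)
pose c := (f b - f a) / (b - a).
pose h x := 2 * c * f x - c ^+ 2 * x.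
have -> : (f b - f a) ^+ 2 / (b - a) = h b - h a.
  by rewrite /h /c; field; rewrite gt_eqF.
apply: increment_le_integral => //.
  apply: (@abs_continuous_le _ _ _ f h (`|2 * c|) (c ^+ 2)) => //.
    exact: sqr_ge0.
  move=> x y ax xy yb; rewrite /h.
  rewrite (_ : _ - _ = (2 * c) * (f y - f x) - c ^+ 2 * (y - x)); last by ring.
  apply: le_trans (ler_normB _ _) _; rewrite (normrM (2 * c)) (normrM (c ^+ 2)).
  rewrite (ger0_norm (sqr_ge0 c)).
  by rewrite (@ger0_norm _ (y - x)) ?subr_ge0.
apply: filterS (abs_continuous_is_derive ab acf).
  exact: (ae_filter_ringOfSetsType mu).
move=> x H /H {}H; exists (2 * c * derive1 f x - c ^+ 2).
  have dh := is_deriveB (is_deriveZ (2 * c) H)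
    (is_deriveZ (c ^+ 2) (is_derive_id x (1 : R))).
  by apply: is_derive_eq dh _; rewrite /GRing.scale/= mulr1.
have := sqr_ge0 (derive1 f x - c); nra.
Qed.

(** The direct half of Riesz's criterion: [increment_energy] on each interval, then additivity of
    the integral over disjoint sets. *)
Lemma abs_continuous_energy_bound a b f : a <= b -> abs_continuous a b f ->
  mu.-integrable `[a, b] (EFin \o (fun x => derive1 f x ^+ 2)) ->
  energy_bound a b f (\int[mu]_(x in `[a, b]) (derive1 f x ^+ 2)).
Proof.
move=> ab acf f2 n l r [lr tlr].
have f2S c d : a <= c -> d <= b ->
    mu.-integrable `[c, d] (EFin \o (fun x => derive1 f x ^+ 2)).
  move=> ac db; apply: integrableS f2 => //.
  by apply: subset_itv; rewrite bnd_simp.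
apply: (@le_trans _ _ (\sum_(i < n) \int[mu]_(x in `]l i, r i[) (derive1 f x ^+ 2))).
  apply: ler_sum => i _; have [al [lri rb]] := lr i.
  rewrite Rintegral_itv_oo_cc; last exact: f2S.
  apply: increment_energy => //; last exact: f2S.
  exact: abs_continuousS acf.
have subi i : `]l i, r i[%classic `<=` `[a, b]%classic.
  by have [al [lri rb]] := lr i; apply: subset_itv; rewrite bnd_simp.
rewrite -lee_fin -sumEFin /Rintegral fineK; last exact: integrable_fin_num.
under eq_bigr => i _.
  rewrite fineK; last first.
    by apply: integrable_fin_num => //; apply: integrableS f2.
  over.
pose D := \big[setU/set0]_(i < n) `]l i, r i[%classic.
have mD : measurable D by exact: bigsetU_measurable.
have Dab : D `<=` `[a, b]%classic.
  by rewrite /D -bigcup_seq => y [i _]; exact: subi.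
rewrite -(@ge0_integral_bigsetU _ _ _ mu 'I_n (fun i => `]l i, r i[%classic)
   (fun x => (derive1 f x ^+ 2)%:E)).
- apply: ge0_subset_integral => //; first exact: measurable_int f2.
  by move=> x _; rewrite lee_fin sqr_ge0.
- by move=> i; exact: measurable_itv.
- exact: index_enum_uniq.
- by move=> i j _ _; exact: tlr.
- exact: measurable_funS (measurable_int mu f2).
- by move=> x _; rewrite lee_fin sqr_ge0.
Qed.

End energy.

Section energy_characterization.
Context {R : realType}.
Notation mu := (@lebesgue_measure R).
Implicit Types (a b C e : R) (f : R -> R).

Lemma energy_bound_ge0 a b f C : energy_bound a b f C -> 0 <= C.
Proof.
move=> fC; have := fC 0%N (fun=> 0) (fun=> 0); rewrite big_ord0; apply.
by split; [case|case].
Qed.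

(** Young's inequality [|x| <= (k * x ^+ 2 / u + u / k) / 2] on each interval of length [u]. The
    choice [k * (C + 1) = e] keeps the first sum below [e], even for [C = 0], and total length below
    [e * k] does the same for the second. *)
Lemma energy_bound_abs_continuous a b f C : energy_bound a b f C ->
  abs_continuous a b f.
Proof.
move=> fC e e0; have C0 := energy_bound_ge0 fC.
have [k k0 kC] : exists2 k, 0 < k & k * (C + 1) = e.
  by exists (e / (C + 1)); rewrite ?divfK ?gt_eqF ?divr_gt0// ltr_wpDl.
exists (e * k); first by rewrite mulr_gt0.
move=> n l r lr tlr sd.
have {}fC := fC n l r (conj lr tlr).
apply: (@le_lt_trans _ _ (2^-1 * (k * \sum_(i < n) (f (r i) - f (l i)) ^+ 2 / (r i - l i)
    + k^-1 * \sum_(i < n) (r i - l i)))).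
  rewrite !mulr_sumr -big_split/= mulr_sumr; apply: ler_sum => i _.
  have [_ [lri _]] := lr i.
  have [->|nlri] := eqVneq (l i) (r i).
    by rewrite !subrr normr0 expr0n/= mul0r !mulr0 addr0 mulr0.
  have u0 : 0 < r i - l i by rewrite subr_gt0 lt_neqAle nlri.
  set u := r i - l i in u0 *; rewrite -(real_normK (num_real (f (r i) - f (l i)))).
  set x := `|f (r i) - f (l i)|.
  rewrite -subr_ge0 (_ : _ - x = (k * x - u) ^+ 2 / (2 * k * u)).
    by apply: divr_ge0; [exact: sqr_ge0|do ?[apply: mulr_ge0]; lra].
  by field; rewrite !gt_eqF.
have kd : k^-1 * \sum_(i < n) (r i - l i) < e.
  by rewrite mulrC ltr_pdivrMr.
have : k * \sum_(i < n) (f (r i) - f (l i)) ^+ 2 / (r i - l i) <= k * C.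
  by rewrite ler_pM2l.
lra.
Qed.

Lemma is_derive_approx f (s d : R) : is_derive s 1 f d -> forall e, 0 < e ->
  exists2 del, 0 < del &
    forall y, `|y - s| < del -> `|f y - f s - d * (y - s)| <= e * `|y - s|.
Proof.
move=> [df dE] e e0.
have {}df : h^-1 *: (f (h *: 1 + s) - f s) @[h --> 0^'] --> d by rewrite -dE.
have /cvgrPdist_le/(_ _ e0)[del /= del0 H] := df.
exists del => // y ysd.
have [->|ys] := eqVneq y s; first by rewrite !subrr mulr0 subrr normr0 mulr0.
have ys0 : y - s != 0 by rewrite subr_eq0.
have := H (y - s); rewrite /= sub0r normrN => /(_ ysd ys0).
rewrite [(y - s)%:A]mulr1 subrK => H'.
rewrite -ler_pdivrMr ?normr_gt0// -normfV -normrM -normrN.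
rewrite (_ : - (_ / _) = d - (y - s)^-1 *: (f y - f s)) //.
by rewrite mulrBl mulfK// opprB mulrC.
Qed.

Section steps.
Variables (a b C : R) (f : R -> R).
Hypotheses (ab : a < b) (fC : energy_bound a b f C).

Let mesh n := (b - a) / n.+1%:R.
Let node n k := a + k%:R * mesh n.
Let slope2 n k := ((f (node n k.+1) - f (node n k)) / mesh n) ^+ 2.
(** Half-open, so that each point of []a, b[] lies in exactly one cell of the uniform partition. *)
Let cell n k : set R := `[node n k, node n k.+1[%classic.
Let step n s := \sum_(k < n.+1) slope2 n k * \1_(cell n k) s.

Let mesh_gt0 n : 0 < mesh n.
Proof. by rewrite divr_gt0// subr_gt0. Qed.

Let nodeS n k : node n k.+1 = node n k + mesh n.
Proof. by rewrite /node -natr1 mulrDl mul1r addrA. Qed.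

Let node_le n k k' : (k <= k')%N -> node n k <= node n k'.
Proof. by move=> kk; rewrite lerD2l ler_wpM2r ?ler_nat// ltW. Qed.

Let node_last n : node n n.+1 = b.
Proof. by rewrite /node /mesh mulrC divfK ?pnatr_eq0// addrC subrK. Qed.

Let node0 n : node n 0 = a.
Proof. by rewrite /node mul0r addr0. Qed.

Let cell_unique n k k' s : cell n k s -> cell n k' s -> k = k'.
Proof.
rewrite /cell /= !in_itv/= => /andP[s1 s2] /andP[s3 s4].
apply/eqP; rewrite eqn_leq; apply/andP; split; rewrite leqNgt; apply/negP => kk.
  by have := node_le n kk; lra.
by have := node_le n kk; lra.
Qed.

Let cell_subset n k : (k < n.+1)%N -> cell n k `<=` `[a, b]%classic.
Proof.
move=> kn s; rewrite /cell /= !in_itv/= => /andP[s1 s2].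
have := node_le n kn; have := node_le n (leq0n k).
by rewrite node0 node_last => ? ?; apply/andP; split; lra.
Qed.

Let step_energy n : \sum_(k < n.+1) slope2 n k * mesh n <= C.
Proof.
pose l (k : 'I_n.+1) := node n k; pose r (k : 'I_n.+1) := node n k.+1.
apply: le_trans (fC (l := l) (r := r) _).
  apply: ler_sum => k _; rewrite /slope2 /l /r nodeS [node n k + _ - _]addrC addKr.
  by rewrite le_eqVlt; apply/orP; left; apply/eqP; field; rewrite gt_eqF.
split=> [k|k k' _ _ [s [/= sk sk']]].
  rewrite /l /r; have := node_le n (leq0n k); have := node_le n (ltn_ord k).
  by rewrite node0 node_last => ? ?; split => //; split => //; exact: node_le.
by apply/val_inj/(@cell_unique n _ _ s); exact: subset_itv_oo_co.
Qed.

Let measurable_step n : measurable_fun setT (step n).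
Proof.
apply: measurable_sum => k; apply: measurable_funM => //.
exact: measurable_indic (measurable_itv _).
Qed.

Let integral_step n : (\int[mu]_(s in `[a, b]) (step n s)%:E <= C%:E)%E.
Proof.
apply: le_trans (_ : ((\sum_(k < n.+1) slope2 n k * mesh n)%:E <= _)%E); last first.
  by rewrite lee_fin.
under eq_integral do rewrite -sumEFin.
rewrite ge0_integral_sum//; first last.
- by move=> k s _; rewrite lee_fin mulr_ge0// sqr_ge0.
- move=> k; apply/measurable_EFinP/measurable_funM => //.
  exact: measurable_indic (measurable_itv _).
rewrite -sumEFin; apply: lee_sum => k _.
under eq_integral do rewrite EFinM.
rewrite ge0_integralZl_EFin ?sqr_ge0//; last first.
  apply/measurable_EFinP; exact: measurable_indic (measurable_itv _).
rewrite integral_indic//; last exact: measurable_itv.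
rewrite setIidl; last exact: cell_subset.
rewrite [leRHS]EFinM lee_wpmul2l ?lee_fin ?sqr_ge0//.
by rewrite /= /cell lebesgue_measure_itv/= lte_fin nodeS ltrDl mesh_gt0 -EFinB lee_fin; lra.
Qed.

(** The nodes [l] and [l + h] of the cell of [s] enclose [s], so the first-order errors
    [e * (s - l)] and [e * (l + h - s)] add up to [e * h], and the slope of the cell is within [e]
    of [d]. *)
Let step_cvg (s d : R) : a < s < b -> is_derive s 1 f d ->
  step n s @[n --> \oo] --> d ^+ 2.
Proof.
move=> /andP[as_ sb] fd.
pose k n := Num.truncn ((s - a) / mesh n).
have ks n : cell n (k n) s.
  rewrite /cell /= in_itv/= /node.
  have sm : 0 <= (s - a) / mesh n by rewrite divr_ge0 ?subr_ge0 ?ltW.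
  have := truncn_itv sm => /andP[+ _]; have := truncnS_gt ((s - a) / mesh n).
  rewrite -/(k n) ltr_pdivrMr// ler_pdivlMr// => ? ?.
  by apply/andP; split; lra.
have kn n : (k n < n.+1)%N.
  rewrite ltnNge; apply/negP => nk; have := node_le n nk.
  by rewrite node_last => ?; have := ks n; rewrite /cell /= in_itv/= => /andP[]; lra.
have stepE n : step n s = slope2 n (k n).
  rewrite /step (bigD1 (Ordinal (kn n)))//= big1 ?addr0 => [|j jk].
    by rewrite indicE mem_set// mulr1.
  rewrite indicE memNset ?mulr0// => js; move/eqP: jk; apply; apply/val_inj.
  exact: cell_unique js (ks n).
under eq_cvg do rewrite stepE.
rewrite /slope2; apply: (@cvg_comp _ _ _ _ (fun x : R => x ^+ 2) _ (nbhs d)); last first.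
  exact: exprn_continuous.
apply/cvgrPdist_le => e e0.
have [del del0 H] := is_derive_approx fd e0.
have mesh_small : \forall n \near \oo, mesh n < del.
  have /cvgrPdist_lt/(_ (del / (b - a)))[|N _ HN] := @cvg_harmonic R.
    by rewrite divr_gt0// subr_gt0.
  exists N => // n Nn; have := HN n Nn; rewrite /= sub0r normrN.
  by rewrite ger0_norm /harmonic// ltr_pdivlMr ?subr_gt0// mulrC.
near=> n.
have md : mesh n < del by near: n.
have := ks n; rewrite /cell /= in_itv/= nodeS => /andP[s1 s2].
set l := node n (k n) in s1 s2 *; set h := mesh n in md s2 *.
have h0 : 0 < h by exact: mesh_gt0.
have Hl := H l; have Hr := H (l + h).
rewrite ler0_norm in Hl; last by lra.
rewrite (@ger0_norm _ (l + h - s)) in Hr; last by lra.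
have {}Hl := Hl ltac:(lra); have {}Hr := Hr ltac:(lra).
rewrite distrC (_ : _ - d = (f (l + h) - f l - d * h) / h); last first.
  by field; rewrite gt_eqF.
rewrite normrM normfV (gtr0_norm h0) ler_pdivrMr//.
move: Hl Hr; rewrite !ler_norml => /andP[? ?] /andP[? ?].
by apply/andP; split; nra.
Unshelve. all: by end_near. Qed.

(** The converse half of Riesz's criterion: the step functions of squared slopes have integral at
    most [C] and converge almost everywhere to the squared derivative, so Fatou's lemma applies. *)
Lemma energy_bound_derive1 :
  mu.-integrable `[a, b] (EFin \o (fun x => derive1 f x ^+ 2)) /\
  \int[mu]_(x in `[a, b]) (derive1 f x ^+ 2) <= C.
Proof.
have acf := energy_bound_abs_continuous fC.
have mf2 : measurable_fun `[a, b] (EFin \o (fun x => derive1 f x ^+ 2)).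
  apply/measurable_EFinP/measurable_funX.
  exact: abs_continuous_measurable_derive1 (ltW ab) acf.
have mstep n : measurable_fun `]a, b[ (EFin \o step n).
  exact/measurable_EFinP/measurable_funTS.
have step0 n x : (0 <= (step n x)%:E)%E.
  by rewrite lee_fin; apply: sumr_ge0 => k _; rewrite mulr_ge0// sqr_ge0.
have mf2o : measurable_fun `]a, b[ (EFin \o (fun x => derive1 f x ^+ 2)).
  by apply: (measurable_funS _ _ mf2) => //; exact: subset_itv_oo_cc.
have le_C : (\int[mu]_(x in `[a, b]) (derive1 f x ^+ 2)%:E <= C%:E)%E.
  rewrite (@integral_itv_bndoo _ a b _ true false)//.
  rewrite (@ge0_ae_eq_integral _ _ _ mu _ _
      (fun x => limn_einf (fun n => (step n x)%:E)))//.
  - apply: le_trans (fatou _ _ _ _) _ => //.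
    rewrite limn_einf_lim; apply: lime_le; first exact: is_cvg_einfs.
    near=> n; apply: ge_ereal_inf; eexists; first by exists n => /=.
    apply: le_trans (integral_step n).
    by rewrite (@integral_itv_bndoo _ a b _ true false)//; exact: mstep.
  (* The lower limit is handled as the opposite of the upper limit of the opposites. *)
  - have : measurable_fun `]a, b[ (fun x => limn_esup (fun n => (- (step n x)%:E)%E)).
      apply: (@measurable_fun_limn_esup _ _ _ _ (fun n x => (- (step n x)%:E)%E)) => n.
      have := measurableT_comp (@oppe_measurable R setT) (mstep n). exact.
    have := @measurableT_comp _ _ _ _ _ _ _ _ _ (@oppe_measurable R setT). by move=> /[apply].
  - by move=> x _; rewrite lee_fin; exact: sqr_ge0.
  - move=> x _; rewrite limn_einf_lim; apply: lime_ge; first exact: is_cvg_einfs.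
    by near=> n; apply: le_ereal_inf_tmp => _ [m _ <-].
  - apply: filterS (abs_continuous_is_derive (ltW ab) acf).
      exact: (ae_filter_ringOfSetsType mu).
    move=> x H; rewrite /= in_itv/= => axb; apply/esym.
    apply: (cvg_limn_einf_sup _).1; apply: cvg_EFin; first by near=> n.
    exact: step_cvg axb (H axb).
have i2 : mu.-integrable `[a, b] (EFin \o (fun x => derive1 f x ^+ 2)).
  apply/integrableP; split => //; apply: le_lt_trans (ltry C).
  apply: le_trans le_C; apply: ge0_le_integral => //.
  - exact: measurableT_comp.
  - by move=> x _ /=; rewrite ger0_norm// sqr_ge0.
split => //; rewrite -lee_fin fineK//; exact: integrable_fin_num.
Unshelve. all: by end_near. Qed.

End steps.
End energy_characterization.

(** * Stability of energy bounds under uniform limits *)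

Section energy_limit.
Context {R : realType}.
Implicit Types (C e : R).

(** The bound for [eta_ i] holds on [[theta, T]] only, but [theta] tends to 0. Endpoints of a given
    family are pushed up to [theta], which keeps the intervals disjoint, and the finite sum of
    quotients then passes to the limit. *)
Lemma energy_bound_limit (T C : R) (eta_ : nat -> R -> R) (eta : R -> R) :
  continuous (eta \o clamp 0 T) ->
  (forall e, 0 < e -> \forall i \near \oo,
    forall s, 0 <= s <= T -> `|eta_ i s - eta s| <= e) ->
  (forall e, 0 < e -> \forall i \near \oo,
    exists theta, [/\ 0 <= theta <= e, theta <= T &
      energy_bound theta T (eta_ i) (C + e)]) ->
  energy_bound 0 T eta C.
Proof.
move=> ceta ucvg ebound n l r [lr tlr].
(* For each tolerance [harmonic k], choose an index [p.1] and a time [p.2] fulfilling both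
   hypotheses. *)
have H k : exists p : nat * R, [/\ 0 <= p.2 <= harmonic k, p.2 <= T,
    energy_bound p.2 T (eta_ p.1) (C + harmonic k) &
    forall s, 0 <= s <= T -> `|eta_ p.1 s - eta s| <= harmonic k].
  have k0 : 0 < harmonic k :> R by rewrite /harmonic invr_gt0.
  have [i [[theta [? ? ?]] ?]] := filter_ex (filterI (ebound _ k0) (ucvg _ k0)).
  by exists (i, theta); split.
have {H}/choice[p pP] := H.
pose th k := (p k).2; pose f k := eta_ (p k).1.
pose shift k x := Num.max (th k) x.
have th_cvg : th k @[k --> \oo] --> (0 : R).
  apply: (@squeeze_cvgr _ _ _ _ (cst 0) (@harmonic R)); last 2 first.
  - exact: cvg_cst.
  - exact: cvg_harmonic.
  by apply: nearW => k; have [] := pP k.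
have shift_cvg x : 0 <= x -> shift k x @[k --> \oo] --> x.
  move=> x0; apply: (@squeeze_cvgr _ _ _ _ (cst x) (fun k => x + th k)).
  - apply: nearW => k; rewrite /shift le_max lexx orbT ge_max lerDl lerDr x0/=.
    by have [/andP[]] := pP k.
  - exact: cvg_cst.
  - by rewrite -[X in _ --> X]addr0; apply: cvgD => //; exact: cvg_cst.
have shift_in k x : 0 <= x -> x <= T -> 0 <= shift k x <= T.
  move=> x0 xT; rewrite /shift le_max ge_max x0 xT orbT andbT/=.
  by have [] := pP k.
have f_cvg x : 0 <= x -> x <= T -> f k (shift k x) @[k --> \oo] --> eta x.
  move=> x0 xT.
  have c1 : (eta \o clamp 0 T) (shift k x) @[k --> \oo] --> (eta \o clamp 0 T) x.
    by apply: cvg_comp; [exact: shift_cvg x0|exact: ceta].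
  have c2 : f k (shift k x) - (eta \o clamp 0 T) (shift k x) @[k --> \oo] --> (0 : R).
    apply/norm_cvg0P; apply: (@squeeze_cvgr _ _ _ _ (cst 0) (@harmonic R)); last 2 first.
    - exact: cvg_cst.
    - exact: cvg_harmonic.
    apply: nearW => k; rewrite normr_ge0/= clamp_id ?shift_in//.
    by have [_ _ _] := pP k; apply; exact: shift_in.
  have -> : (fun k => f k (shift k x)) = (fun k => f k (shift k x)
      - (eta \o clamp 0 T) (shift k x) + (eta \o clamp 0 T) (shift k x)).
    by apply/funext => k; rewrite subrK.
  have -> : eta x = 0 + (eta \o clamp 0 T) x by rewrite add0r /= clamp_id ?x0.
  exact: cvgD c2 c1.
have inlr i : [/\ 0 <= l i, l i <= r i & r i <= T] by have [? [? ?]] := lr i.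
have S_cvg : \sum_(i < n) (f k (shift k (r i)) - f k (shift k (l i))) ^+ 2
      / (shift k (r i) - shift k (l i)) @[k --> \oo] -->
    \sum_(i < n) (eta (r i) - eta (l i)) ^+ 2 / (r i - l i).
  apply: cvg_big => // [|i _]; first exact: add_continuous.
   have [l0 lri rT] := inlr i.
  (* Inversion is not continuous at 0, but a degenerate interval stays degenerate after the shift
     and its term is constantly 0. *)
  have [rl|rl] := eqVneq (l i) (r i).
    rewrite rl subrr expr0n/= mul0r.
    rewrite (_ : (fun k => _) = cst 0); first exact: cvg_cst.
    by apply/funext => k; rewrite subrr expr0n/= mul0r.
  have [r0 lT] : 0 <= r i /\ l i <= T by split; lra.
  apply: cvgM; last first.
    apply: cvgV; first by rewrite subr_eq0 eq_sym.
    by apply: cvgB; exact: shift_cvg.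
  apply: (@cvg_comp _ _ _ _ (fun x : R => x ^+ 2) _ (nbhs (eta (r i) - eta (l i)))).
    by apply: cvgB; exact: f_cvg.
  exact: exprn_continuous.
have C_cvg : C + harmonic k @[k --> \oo] --> C.
  rewrite -[X in _ --> X]addr0; apply: cvgD; first exact: cvg_cst.
  exact: cvg_harmonic.
apply: (ler_cvg_to S_cvg C_cvg); apply: nearW => k.
have [th0 thT fb _] := pP k; apply: fb; split => [i|i j _ _ [y [/=]]].
  have [l0 lri rT] := inlr i; rewrite /shift; split; first by rewrite le_max lexx.
  split; last by rewrite ge_max thT rT.
  by rewrite ge_max !le_max lexx lri orbT.
rewrite /shift !in_itv/= !gt_max !lt_max => /andP[/andP[ty liy] yi] /andP[/andP[_ ljy] yj].
apply: tlr => //; exists y; split => /=; rewrite in_itv/=.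
  by rewrite liy; case/orP: yi => //; rewrite ltNge (ltW ty).
by rewrite ljy; case/orP: yj => //; rewrite ltNge (ltW ty).
Qed.

End energy_limit.

(** * Braking curves *)

Section competitors.
Context {R : realType}.
Implicit Types (a b C e theta : R) (f xi eta : R -> R).

(** In this division-free form the point [y = s] needs no separate treatment. *)
Lemma derive_withinP (A : set R) f s d : derive_within A f s d <->
  forall e, 0 < e -> exists2 del, 0 < del & forall y, A y -> `|y - s| < del ->
    `|f y - f s - d * (y - s)| <= e * `|y - s|.
Proof.
split=> [fd e e0|H].
  have /cvgrPdist_le/(_ _ e0) := fd.
  rewrite /dnbhs near_withinE near_withinE => -[del /= del0 H].
  exists del => // y Ay ysd.
  have [->|ys] := eqVneq y s; first by rewrite !subrr mulr0 subrr normr0 mulr0.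
  have ys0 : y - s != 0 by rewrite subr_eq0.
  have := H y; rewrite /= distrC => /(_ ysd ys Ay) H'.
  rewrite -ler_pdivrMr ?normr_gt0// -normfV -normrM -normrN.
  by rewrite mulrBl mulfK// opprB.
apply/cvgrPdist_le => e e0; rewrite /dnbhs near_withinE near_withinE.
have [del del0 {}H] := H _ e0; exists del => // y; rewrite /= distrC => ysd ys Ay.
have ys0 : y - s != 0 by rewrite subr_eq0.
have := H y Ay ysd; rewrite -ler_pdivrMr ?normr_gt0// -normfV -normrM -normrN.
by rewrite mulrBl mulfK// opprB.
Qed.

(* [brake theta s ^+ 2] is the velocity which, starting from 1, stops after the
   distance [theta / 3] with the least energy. *)
Definition brake theta s : R := Num.max 0 (1 - s / theta).

Lemma brake_ge0 theta s : 0 <= brake theta s.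
Proof. by rewrite /brake le_max lexx. Qed.

Lemma brake_le1 theta s : 0 < theta -> 0 <= s -> brake theta s <= 1.
Proof.
by move=> t0 s0; rewrite /brake ge_max ler01 gerBl divr_ge0// ltW.
Qed.

Lemma brake0 theta : brake theta 0 = 1.
Proof. by rewrite /brake mul0r subr0 max_r. Qed.

Lemma brake_eq0 theta s : 0 < theta -> theta <= s -> brake theta s = 0.
Proof. by move=> t0 ts; rewrite /brake max_l// subr_le0 ler_pdivlMr// mul1r. Qed.

Lemma brake_le theta : 0 < theta -> {homo brake theta : x y / x <= y >-> y <= x}.
Proof.
move=> t0 x y xy; rewrite /brake ge_max !le_max lexx/=; apply/orP; right.
by rewrite lerD2l lerN2 ler_pM2r ?invr_gt0.
Qed.

Lemma brake_sub theta l r : 0 < theta -> l <= r ->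
  theta * (brake theta l - brake theta r) <= r - l.
Proof.
move=> t0 lr; rewrite -ler_pdivlMl// mulrC.
have : l / theta <= r / theta by rewrite ler_pM2r ?invr_gt0.
by rewrite mulrBl /brake /Num.max; do ?[case: ltP => ?]; lra.
Qed.

(** The primitive of [brake theta s ^+ 2] on [s >= 0] that vanishes at 0; it stays at [theta / 3]
    from the time [theta] on. *)
Definition brake_pos theta s := theta / 3 * (1 - brake theta s ^+ 3).

(** Second-order Taylor bound for the cube of the positive part, checked according to the signs of
    [u] and [v]; the constant 6 covers all cases. *)
Lemma pos_part_cube (u v : R) : u <= 1 -> `|v - u| <= 1 ->
  `|Num.max 0 v ^+ 3 - Num.max 0 u ^+ 3 - 3 * Num.max 0 u ^+ 2 * (v - u)| <=
  6 * `|v - u| ^+ 2.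
Proof.
move=> u1 vu1.
rewrite real_normK ?num_real//; move: vu1; rewrite !ler_norml => /andP[d1 d2].
have d20 : 0 <= (v - u) ^+ 2 by exact: sqr_ge0.
rewrite /Num.max; case: (ltP 0 u) => u0; case: (ltP 0 v) => v0.
- rewrite (_ : _ - _ - _ = (v - u) ^+ 2 * (v + 2 * u)); last by ring.
  by apply/andP; split; nra.
- rewrite (_ : _ - _ - _ = u ^+ 2 * (2 * u - 3 * v)); last by ring.
  have u2 : u ^+ 2 <= (v - u) ^+ 2 by nra.
  have u20 : 0 <= u ^+ 2 by exact: sqr_ge0.
  have [w0 w6] : 0 <= 2 * u - 3 * v /\ 2 * u - 3 * v <= 6 by split; lra.
  apply/andP; split; first by apply: le_trans (mulr_ge0 u20 w0); lra.
  by rewrite mulrC; apply: ler_pM.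
- rewrite (_ : _ - _ - _ = v ^+ 2 * v); last by ring.
  have v2 : v ^+ 2 <= (v - u) ^+ 2 by nra.
  have v20 : 0 <= v ^+ 2 by exact: sqr_ge0.
  apply/andP; split; first by apply: le_trans (mulr_ge0 v20 (ltW v0)); lra.
  by rewrite mulrC; apply: ler_pM => //; lra.
- by rewrite (_ : _ - _ - _ = 0); [apply/andP; split; lra|ring].
Qed.

Lemma derive_brake_pos (A : set R) theta s : 0 < theta -> 0 <= s ->
  derive_within A (brake_pos theta) s (brake theta s ^+ 2).
Proof.
move=> t0 s0; apply/derive_withinP => e e0.
exists (Num.min theta (e * theta / 2)).
  by rewrite lt_min t0 !mulr_gt0.
move=> y _; rewrite lt_min => /andP[yt ye].
set u := 1 - s / theta; set v := 1 - y / theta.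
have vu : y - s = - theta * (v - u).
  by rewrite /u /v; field; rewrite gt_eqF.
have vu1 : `|v - u| <= 1.
  move: yt; rewrite vu normrM normrN (gtr0_norm t0) => /ltW.
  by rewrite ger_pMr.
have vue : `|v - u| <= e / 2.
  move: ye; rewrite vu normrM normrN (gtr0_norm t0) => /ltW ye.
  by rewrite -(ler_pM2l t0); lra.
have u1 : u <= 1 by rewrite /u gerBl divr_ge0// ltW.
rewrite vu normrM normrN (gtr0_norm t0) /brake_pos /brake -/u -/v.
set p := Num.max 0 u; set q := Num.max 0 v.
rewrite (_ : _ - _ = - (theta / 3) * (q ^+ 3 - p ^+ 3 - 3 * p ^+ 2 * (v - u))); last first.
  by field.
rewrite normrM normrN (@gtr0_norm _ (theta / 3)) ?divr_gt0//.
rewrite [leRHS](_ : _ = theta / 3 * (3 * (e * `|v - u|))); last by field.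
rewrite ler_pM2l ?divr_gt0//.
have key := pos_part_cube u1 vu1; rewrite -/p -/q in key.
apply: le_trans key _; have := normr_ge0 (v - u); nra.
Qed.

(** For [0 <= l] the right-hand side is the integral over [[l, r]] of the squared derivative of
    [brake theta s ^+ 2]; being an increment, it can be summed over disjoint intervals. *)
Lemma brake_energy theta l r : 0 < theta -> l <= r ->
  (brake theta r ^+ 2 - brake theta l ^+ 2) ^+ 2 / (r - l) <=
  4 / (3 * theta) * (brake theta l ^+ 3 - brake theta r ^+ 3).
Proof.
move=> t0 lr; have [<-|nlr] := eqVneq l r.
  by rewrite !subrr mulr0 invr0 mulr0.
have rl : 0 < r - l by rewrite subr_gt0 lt_neqAle nlr.
rewrite ler_pdivrMr//.
have := brake_sub t0 lr; have := brake_le t0 lr.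
have := brake_ge0 theta r; have := brake_ge0 theta l.
set p := brake theta l; set q := brake theta r => p0 q0 qp pq.
have pq3 : 0 <= p ^+ 3 - q ^+ 3 by rewrite subr_ge0 lerXn2r.
(* What remains is [(q^2 - p^2)^2 <= 4/3 (p^3 - q^3) (p - q)], where the two sides differ by
   [(p - q)^4 / 3]. *)
apply: (@le_trans _ _ (4 / (3 * theta) * (p ^+ 3 - q ^+ 3) * (theta * (p - q)))).
  rewrite (_ : 4 / (3 * theta) * _ * _ = 4 / 3 * (p ^+ 3 - q ^+ 3) * (p - q)).
    rewrite -subr_ge0 (_ : _ - _ = (p - q) ^+ 4 / 3).
      by rewrite divr_ge0// exprn_even_ge0.
    by field.
  by field; rewrite gt_eqF.
by apply: ler_wpM2l => //; rewrite mulr_ge0// divr_ge0// mulr_ge0// ltW.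
Qed.

Lemma sum_brake_le T theta n (l r : 'I_n -> R) : 0 < theta -> 0 <= T ->
  disjoint_family 0 T l r ->
  \sum_(i < n) (brake theta (l i) ^+ 3 - brake theta (r i) ^+ 3) <= 1.
Proof.
move=> t0 T0 lr.
have H := @disjoint_family_nondecreasing R 0 T (fun s => - brake theta s ^+ 3) n l r T0 _ lr.
apply: le_trans (le_trans (H _) _); last 2 first.
- move=> x y _ _ xy; rewrite lerN2 lerXn2r ?nnegrE ?brake_ge0//.
  exact: brake_le.
- rewrite brake0 expr1n opprK gerDr oppr_le0.
  by rewrite exprn_ge0 ?brake_ge0.
by apply: ler_sum => i _; rewrite opprK addrC.
Qed.

(** Young's inequality [(a + b)^2 <= (1 + m) a^2 + (1 + 1/m) b^2]. A small [m] makes the loss on [C]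
    small, and [w ^+ 2 / theta] is made small afterwards. *)
Lemma energy_bound_combination T theta eta k w m C : 0 < theta -> 0 <= T ->
  0 <= k <= 1 -> 0 < m -> energy_bound 0 T eta C ->
  energy_bound 0 T (fun s => k * eta s + w * brake theta s ^+ 2)
    ((1 + m) * C + (1 + m^-1) * (4 / 3 * (w ^+ 2 / theta))).
Proof.
move=> t0 T0 /andP[k0 k1] m0 etaC n l r lr.
have S1 := etaC n l r lr; have S2 := sum_brake_le t0 T0 lr.
have mV : 0 < m^-1 by rewrite invr_gt0.
apply: (@le_trans _ _ (\sum_(i < n) ((1 + m) *
   ((eta (r i) - eta (l i)) ^+ 2 / (r i - l i)) + (1 + m^-1) * (4 / 3 * (w ^+ 2 / theta)) *
     (brake theta (l i) ^+ 3 - brake theta (r i) ^+ 3)))); last first.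
  rewrite big_split/= -!mulr_sumr lerD// ?ler_pM2l ?addr_gt0//.
  rewrite -[leRHS]mulr1 ler_wpM2l// mulr_ge0//; first by rewrite addr_ge0// ltW.
  by rewrite mulr_ge0// divr_ge0// ?sqr_ge0// ltW.
apply: ler_sum => i _; have [_ [lri _]] := lr.1 i.
have B := brake_energy t0 lri.
set p := brake theta (l i) in B *; set q := brake theta (r i) in B *.
set x := eta (r i) - eta (l i); set d := r i - l i in B *.
rewrite (_ : _ - _ = k * x + w * (q ^+ 2 - p ^+ 2)); last by rewrite /x; ring.
set y := q ^+ 2 - p ^+ 2 in B *.
have dV : 0 <= d^-1 by rewrite invr_ge0 subr_ge0.
apply: (@le_trans _ _ ((1 + m) * (x ^+ 2 / d) + (1 + m^-1) * w ^+ 2 * (y ^+ 2 / d))).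
  rewrite [leRHS](_ : _ =
    ((1 + m) * x ^+ 2 + (1 + m^-1) * (w * y) ^+ 2) * d^-1); last by ring.
  rewrite ler_wpM2r//.
  have k2 : k ^+ 2 <= 1 by rewrite expr_le1.
  have kx : (k * x) ^+ 2 <= x ^+ 2 by rewrite exprMn ler_piMl// sqr_ge0.
  set z := w * y; set x' := k * x in kx *.
  apply: (@le_trans _ _ ((1 + m) * x' ^+ 2 + (1 + m^-1) * z ^+ 2)).
    rewrite -subr_ge0 (_ : _ - _ = (m * x' - z) ^+ 2 / m).
      by rewrite divr_ge0// ?sqr_ge0// ltW.
    by field; rewrite gt_eqF.
  by rewrite lerD2r ler_pM2l// addr_gt0.
rewrite lerD2l.
apply: (@le_trans _ _ ((1 + m^-1) * w ^+ 2 * (4 / (3 * theta) * (p ^+ 3 - q ^+ 3)))).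
  by rewrite ler_wpM2l// mulr_ge0// ?sqr_ge0// addr_ge0// ltW.
by rewrite le_eqVlt; apply/orP; left; apply/eqP; field; rewrite !gt_eqF.
Qed.

Definition delay theta s : R := Num.max 0 (s - theta).

(** Braking takes place before [theta] and the delayed curve moves after it, so the two energies add
    without cross term. An interval which straddles [theta] is split there. *)
Lemma energy_bound_delay T theta eta w C : 0 < theta -> 0 <= T ->
  energy_bound 0 T eta C ->
  energy_bound 0 T (fun s => eta (delay theta s) + w * brake theta s ^+ 2)
    (C + 4 / 3 * (w ^+ 2 / theta)).
Proof.
move=> t0 T0 etaC n l r lr.
have lr' : disjoint_family 0 T (fun i => delay theta (l i)) (fun i => delay theta (r i)).
  split=> [i|i j _ _ [y [/=]]].
    have [? [? ?]] := lr.1 i.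
    by rewrite /delay /Num.max; do ?[case: ltP => ?]; lra.
  rewrite !in_itv/= /delay !gt_max !lt_max => /andP[/andP[y0 ly] yr] /andP[/andP[_ ly'] yr'].
  apply: lr.2 => //; exists (y + theta); split => /=; rewrite in_itv/=.
    by case/orP: yr => ?; apply/andP; split; lra.
  by case/orP: yr' => ?; apply/andP; split; lra.
have S1 := etaC n _ _ lr'; have S2 := sum_brake_le t0 T0 lr.
have W0 : 0 <= 4 / 3 * (w ^+ 2 / theta).
  by rewrite mulr_ge0// divr_ge0// ?sqr_ge0// ltW.
apply: (@le_trans _ _ (\sum_(i < n)
   ((eta (delay theta (r i)) - eta (delay theta (l i))) ^+ 2 /
      (delay theta (r i) - delay theta (l i)) + 4 / 3 * (w ^+ 2 / theta) *
     (brake theta (l i) ^+ 3 - brake theta (r i) ^+ 3)))); last first.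
  rewrite big_split/= -mulr_sumr lerD//.
  by rewrite -[leRHS]mulr1 ler_wpM2l.
apply: ler_sum => i _; have [_ [lri _]] := lr.1 i.
have Bw u v : u <= v -> (w * (brake theta v ^+ 2 - brake theta u ^+ 2)) ^+ 2 / (v - u) <=
    4 / 3 * (w ^+ 2 / theta) * (brake theta u ^+ 3 - brake theta v ^+ 3).
  move=> uv; have B := ler_wpM2l (sqr_ge0 w) (brake_energy t0 uv).
  apply: le_trans (le_trans B _); first by rewrite le_eqVlt; apply/orP; left; apply/eqP; ring.
  by rewrite le_eqVlt; apply/orP; left; apply/eqP; field; rewrite !gt_eqF.
have d_le s : s <= theta -> delay theta s = 0.
  by move=> st; rewrite /delay max_l// subr_le0.
have d_ge s : theta <= s -> delay theta s = s - theta.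
  by move=> st; rewrite /delay max_r// subr_ge0.
have [rt|tr] := leP (r i) theta.
  rewrite !d_le// ?(le_trans lri)// !subrr expr0n/= mul0r add0r.
  apply: le_trans _ (Bw _ _ lri).
  by rewrite le_eqVlt; apply/orP; left; apply/eqP; congr (_ ^+ 2 / _); ring.
have [tl|lt] := leP theta (l i).
  rewrite !d_ge ?(ltW tr)// (brake_eq0 t0 tl) (brake_eq0 t0 (ltW tr)).
  rewrite !expr0n/= !mulr0 subrr mulr0 !addr0.
  by rewrite le_eqVlt; apply/orP; left; apply/eqP; congr (_ / _); ring.
rewrite (d_ge _ (ltW tr)) (d_le _ (ltW lt)) subr0.
have := Bw _ _ (ltW lt); rewrite (brake_eq0 t0 (ltW tr)) (brake_eq0 t0 (lexx theta)).
rewrite !expr0n/= subr0 sub0r mulr0 addr0.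
set p := brake theta (l i); move=> B.
have ut : 0 < r i - theta by rewrite subr_gt0.
have vt : 0 < theta - l i by rewrite subr_gt0.
apply: le_trans (lerD (lexx _) B).
set u := r i - theta in ut *; set v := theta - l i in vt *.
have -> : r i - l i = u + v by rewrite /u /v; ring.
set x := eta u - eta 0; rewrite (_ : _ - _ = x + w * - p ^+ 2); last by rewrite /x; ring.
set y := w * - p ^+ 2.
(* This is the convexity inequality [(x + y)^2 / (u + v) <= x^2 / u + y^2 / v]. *)
rewrite -subr_ge0 (_ : _ - _ = (v * x - u * y) ^+ 2 / (u * v * (u + v))); last first.
  by field; rewrite !gt_eqF// addr_gt0.
by rewrite divr_ge0 ?sqr_ge0// ltW// !mulr_gt0// addr_gt0.
Qed.

End competitors.

(** * Derivatives and continuity on a segment *)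

Section curves.
Context {R : realType}.
Notation mu := (@lebesgue_measure R).
Implicit Types (a b C e T theta : R) (f xi eta : R -> R).

Lemma derive_within_is_derive a b f s d : a < s < b ->
  derive_within `[a, b] f s d -> is_derive s 1 f d.
Proof.
move=> /andP[as_ sb] /derive_withinP H.
have cv : h^-1 *: (f (h *: 1 + s) - f s) @[h --> 0^'] --> d.
  apply/cvgrPdist_le => e e0; have [del del0 {}H] := H _ e0.
  exists (Num.min del (Num.min (s - a) (b - s))) => /=.
    by rewrite !lt_min del0 !subr_gt0 as_ sb.
  move=> h; rewrite /= sub0r normrN !lt_min => /andP[hd /andP[ha hb]] h0.
  rewrite [h%:A]mulr1; have := H (h + s).
  rewrite addrK => /(_ _ hd) H'.
  have {}H' : `|f (h + s) - f s - d * h| <= e * `|h|.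
    apply: H'; rewrite /= in_itv/=.
    by move: ha hb; rewrite !ltr_norml => /andP[? ?] /andP[? ?]; apply/andP; split; lra.
  rewrite -ler_pdivrMr ?normr_gt0// -normfV -normrM -normrN in H'.
  move: H'; rewrite mulrBl mulfK// opprB [X in d - X]mulrC; exact.
apply: DeriveDef; first by apply/cvg_ex; exists d.
by apply/cvg_lim.
Qed.

Lemma within_continuousP (A : set R) f : {within A, continuous f} <->
  forall x, A x -> forall e, 0 < e -> exists2 del, 0 < del &
    forall y, A y -> `|y - x| < del -> `|f y - f x| <= e.
Proof.
rewrite subspace_continuousP; split=> H x Ax.
  move=> e e0; have /cvgrPdist_le/(_ _ e0) := H x Ax.
  rewrite near_withinE => -[del /= del0 {}H]; exists del => // y Ay.
  by rewrite distrC => yd; rewrite distrC; exact: H.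
apply/cvgrPdist_le => e e0; have [del del0 {}H] := H x Ax e e0.
rewrite near_withinE; exists del => //= y; rewrite /ball_ /= distrC => yd Ay.
by rewrite distrC; exact: H.
Qed.

Lemma derive_within_continuous (A : set R) f (f' : R -> R) :
  (forall s, A s -> derive_within A f s (f' s)) -> {within A, continuous f}.
Proof.
move=> df; apply/within_continuousP => x Ax e e0.
have /derive_withinP/(_ _ ltr01)[del del0 H] := df _ Ax.
have m0 : 0 < 1 + `|f' x| by rewrite ltr_pwDl.
exists (Num.min del (e / (1 + `|f' x|))); first by rewrite lt_min del0 divr_gt0.
move=> y Ay; rewrite lt_min ltr_pdivlMr// => /andP[yd ye].
have := H y Ay yd; rewrite mul1r => {}H.
rewrite -(subrK (f' x * (y - x)) (f y - f x)).
apply: le_trans (ler_normD _ _) _; apply: le_trans (ltW ye).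
by rewrite [leRHS]mulrDr mulr1 [in leRHS]mulrC -normrM lerD2r.
Qed.

Lemma clamp_continuous_within a b f : a <= b ->
  {within `[a, b], continuous f} <-> continuous (f \o clamp a b).
Proof.
move=> ab; split=> [/within_continuousP H x|cf].
  apply/cvgrPdist_le => e e0.
  have Ax : `[a, b]%classic (clamp a b x) by rewrite /= in_itv/= clamp_in.
  have [del del0 {}H] := H _ Ax e e0; exists del => //= y; rewrite /ball_ /= => yx.
  rewrite distrC; apply: H; first by rewrite /= in_itv/= clamp_in.
  apply: le_lt_trans yx; have [xy|/ltW yx] := leP x y.
    rewrite [leRHS]distrC !ger0_norm ?subr_ge0 ?clamp_nondecreasing//.
    exact: clamp_dist.
  rewrite distrC !ger0_norm ?subr_ge0 ?clamp_nondecreasing//.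
  exact: clamp_dist.
apply: (@subspace_eq_continuous _ _ _ (f \o clamp a b)).
  by move=> x; rewrite inE/= in_itv/= => xab; rewrite clamp_id.
exact: continuous_subspaceT.
Qed.

Lemma abs_continuous_clamp a b f : a <= b -> abs_continuous a b f ->
  continuous (f \o clamp a b).
Proof.
by move=> ab acf; apply: seq_abs_continuous_clamp => // e; exact: abs_continuous_seq.
Qed.

Lemma abs_continuous_within a b f : a <= b -> abs_continuous a b f ->
  {within `[a, b], continuous f}.
Proof. by move=> ab acf; apply/clamp_continuous_within => //; exact: abs_continuous_clamp. Qed.

Lemma within_bounded a b f : a <= b -> {within `[a, b], continuous f} ->
  exists2 M, 0 <= M & forall s, a <= s <= b -> `|f s| <= M.
Proof.
move=> ab cf.
have cn : {within `[a, b], continuous (fun s => `|f s|)}.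
  apply/clamp_continuous_within => // s; apply: cvg_norm.
  by move/(clamp_continuous_within _ ab) : cf; exact.
have [c cab H] := EVT_max ab cn.
by exists `|f c| => // s sab; apply: H; rewrite in_itv.
Qed.

Lemma derive_within_MVT a b f (f' : R -> R) x y :
  (forall s, s \in `[a, b] -> derive_within `[a, b] f s (f' s)) ->
  a <= x -> x <= y -> y <= b ->
  exists2 c, x <= c <= y & f y - f x = f' c * (y - x).
Proof.
move=> df ax xy yb.
have cf : {within `[a, b], continuous f}.
  by apply: (@derive_within_continuous _ _ f').
have {}cf : {within `[x, y], continuous f}.
  by apply: continuous_subspaceW cf; apply: subset_itv; rewrite bnd_simp.
have dfi s : s \in `]x, y[ -> is_derive s 1 f (f' s).
  rewrite in_itv/= => /andP[? ?].
  apply: (@derive_within_is_derive a b); first by apply/andP; split; lra.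
  by apply: df; rewrite in_itv/=; apply/andP; split; lra.
have [c cxy E] := MVT_segment xy dfi cf.
by exists c => //; move: cxy; rewrite in_itv.
Qed.

Lemma energy_bound_Gamma T xi eta C : 0 < T ->
  (forall s, s \in `[0, T] ->
    derive_within `[0, T] xi s (eta s) /\ Xi R (xi s, eta s)) ->
  energy_bound 0 T eta C -> Gamma T (xi, eta).
Proof.
move=> T0 H etaC; split => //=; last exact: energy_bound_abs_continuous etaC.
exists eta; last by move=> t /= /H[].
apply: abs_continuous_within (ltW T0) _.
exact: energy_bound_abs_continuous etaC.
Qed.

End curves.

(** * Admissibility of the braking curves and the least braking energy *)

Section competitor_curves.
Context {R : realType}.
Notation mu := (@lebesgue_measure R).
Implicit Types (a b C e T theta : R) (f xi eta : R -> R).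

(** The pointwise half of [Gamma]; its regularity half follows from an energy bound by
    [energy_bound_Gamma]. *)
Definition admissible T xi eta := forall s, s \in `[0, T] ->
  derive_within `[0, T] xi s (eta s) /\ Xi R (xi s, eta s).

Lemma XiE (x v : R) : Xi R (x, v) <-> -1 <= x <= 0.
Proof. by rewrite /Xi; split=> [[/= + _]|H]; [|split => //=]; rewrite in_itv. Qed.

Lemma derive_withinD (A : set R) f g s d d' :
  derive_within A f s d -> derive_within A g s d' ->
  derive_within A (fun y => f y + g y) s (d + d').
Proof.
move=> df dg; rewrite /derive_within.
rewrite (_ : (fun y => _) =
    (fun y => (f y - f s) / (y - s) + (g y - g s) / (y - s))); last first.
  by apply/funext => y; rewrite -mulrDl; congr (_ * _); ring.
exact: cvgD.
Qed.

Lemma derive_withinZ (A : set R) k f s d :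
  derive_within A f s d -> derive_within A (fun y => k * f y) s (k * d).
Proof.
move=> df; rewrite /derive_within.
rewrite (_ : (fun y => _) = (fun y => k * ((f y - f s) / (y - s)))); last first.
  by apply/funext => y; ring.
by apply: cvgM; [exact: cvg_cst|].
Qed.

Lemma derive_within_cst (A : set R) (c s : R) : derive_within A (fun=> c) s 0.
Proof.
rewrite /derive_within.
rewrite (_ : (fun y => _) = cst 0); first exact: cvg_cst.
by apply/funext => y; rewrite subrr mul0r.
Qed.

(** Writes a braking position as an interpolation, so that the state constraint has to be checked
    only at the start and at the stop. *)
Lemma brake_pos_itv theta s : 0 < theta -> 0 <= s ->
  exists2 t, 0 <= t <= 1 & brake_pos theta s = theta / 3 * t.
Proof.
move=> t0 s0; exists (1 - brake theta s ^+ 3) => //.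
have b0 := brake_ge0 theta s; have b1 := brake_le1 t0 s0.
have : 0 <= brake theta s ^+ 3 by exact: exprn_ge0.
have : brake theta s ^+ 3 <= 1 by rewrite exprn_ile1.
by move=> ? ?; apply/andP; split; lra.
Qed.

(** [(1 - k) * xi] stays in [[-(1 - k), 0]], and the braking part runs between [Y] and
    [Y + w * theta / 3], both in [[-k, 0]]. *)
Lemma admissible_combination T theta k Y w xi eta : 0 < theta -> 0 <= k <= 1 ->
  - k <= Y <= 0 -> - k <= Y + w * theta / 3 <= 0 -> admissible T xi eta ->
  admissible T (fun s => (1 - k) * xi s + (Y + w * brake_pos theta s))
    (fun s => (1 - k) * eta s + w * brake theta s ^+ 2).
Proof.
move=> t0 /andP[k0 k1] /andP[Y1 Y2] /andP[Z1 Z2] H s sT; have [dxi xiX] := H s sT.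
have s0 : 0 <= s by move: sT; rewrite in_itv/= => /andP[].
split.
  apply: derive_withinD; first exact: derive_withinZ.
  rewrite -[w * _]add0r; apply: derive_withinD; first exact: derive_within_cst.
  by apply: derive_withinZ; exact: derive_brake_pos.
move/XiE: xiX => /andP[x1 x2]; apply/XiE.
have [t /andP[t1 t2] ->] := brake_pos_itv t0 s0.
have -> : Y + w * (theta / 3 * t) = (1 - t) * Y + t * (Y + w * theta / 3) by ring.
set Z := Y + w * theta / 3 in Z1 Z2 *.
have A1 : (1 - t) * - k <= (1 - t) * Y by rewrite ler_wpM2l// subr_ge0.
have A2 : (1 - t) * Y <= 0 by rewrite mulr_ge0_le0// subr_ge0.
have B1 : t * - k <= t * Z by rewrite ler_wpM2l.
have B2 : t * Z <= 0 by rewrite mulr_ge0_le0.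
have C1 : (1 - k) * -1 <= (1 - k) * xi s by rewrite ler_wpM2l// subr_ge0.
have C2 : (1 - k) * xi s <= 0 by rewrite mulr_ge0_le0// subr_ge0.
by apply/andP; split; lra.
Qed.

(** [delay theta] has a corner at [theta], which is harmless because the velocity [eta 0] at which
    [xi] is entered vanishes. *)
Lemma derive_delay T theta xi eta s : 0 < theta -> eta 0 = 0 ->
  admissible T xi eta -> s \in `[0, T] ->
  derive_within `[0, T] (xi \o delay theta) s (eta (delay theta s)).
Proof.
move=> t0 eta0 H; rewrite in_itv/= => /andP[s0 sT].
have d_in y : 0 <= y -> y <= T -> delay theta y \in `[0, T].
  move=> y0 yT; rewrite in_itv/= /delay /Num.max.
  by case: ltP => ?; apply/andP; split; lra.
have [/derive_withinP D _] := H _ (d_in s s0 sT).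
apply/derive_withinP => e e0; have [del del0 {}D] := D e e0.
(* For [s > theta] the gap keeps [y] beyond [theta], where [delay] is a translation; for
   [s <= theta] both linear terms vanish and any gap will do. *)
pose gap := if s <= theta then 1 else s - theta.
have gap0 : 0 < gap by rewrite /gap; case: (leP s theta) => ?; lra.
exists (Num.min del gap); first by rewrite lt_min del0.
move=> y; rewrite /= in_itv/= => /andP[y0 yT]; rewrite lt_min => /andP[yd yg].
have dd : `|delay theta y - delay theta s| <= `|y - s|.
  rewrite ler_norml /delay /Num.max; have := ler_norm (y - s).
  have := ler_norm (s - y); rewrite distrC.
  by case: (ltP 0 (y - theta)) => ?; case: (ltP 0 (s - theta)) => ? ? ?;
    apply/andP; split; lra.
have := D (delay theta y) (d_in y y0 yT) (le_lt_trans dd yd).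
have -> : eta (delay theta s) * (delay theta y - delay theta s) =
    eta (delay theta s) * (y - s).
  have [st|ts] := leP s theta.
    by rewrite [in eta _]/delay max_l ?subr_le0// eta0 !mul0r.
  move: yg; rewrite /gap leNgt ts/= ltr_norml => /andP[yg _].
  by congr (_ * _); rewrite /delay !max_r; lra.
by move=> /le_trans; apply; rewrite ler_wpM2l// ltW.
Qed.

(** [A + w * theta / 3 = 0] says that braking from [x + A] ends exactly at [x]; until then the
    position lies between these two points of the strip. *)
Lemma admissible_delay T theta A w x xi eta : 0 < theta -> 0 <= T ->
  eta 0 = 0 -> xi 0 = x -> -1 <= x + A <= 0 -> A + w * theta / 3 = 0 ->
  admissible T xi eta ->
  admissible T (fun s => (A + w * brake_pos theta s) + xi (delay theta s))
    (fun s => eta (delay theta s) + w * brake theta s ^+ 2).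
Proof.
move=> t0 T0 eta0 xi0 xA Aw H s sT.
have /andP[s0 sT'] : 0 <= s <= T by move: sT; rewrite in_itv.
split.
  rewrite [X in derive_within _ _ _ X]addrC; apply: derive_withinD.
    rewrite -[w * _]add0r; apply: derive_withinD; first exact: derive_within_cst.
    by apply: derive_withinZ; exact: derive_brake_pos.
  exact: (derive_delay t0 eta0 H).
have X0 : -1 <= x <= 0.
  have [|_ /XiE] := H 0; first by rewrite in_itv/= lexx T0.
  by rewrite xi0.
apply/XiE; have [st|ts] := leP s theta.
  rewrite [delay _ _]max_l ?subr_le0// xi0.
  have [t /andP[t1 t2] ->] := brake_pos_itv t0 s0.
  have -> : A + w * (theta / 3 * t) = (1 - t) * A + t * (A + w * theta / 3) by ring.
  rewrite Aw mulr0 addr0.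
  move: xA X0 => /andP[? ?] /andP[? ?]; apply/andP; split; nra.
rewrite /brake_pos brake_eq0 ?(ltW ts)// expr0n/= subr0 mulr1 mulrA Aw add0r.
have [|_ /XiE] := H (delay theta s); last by [].
by rewrite in_itv/= /delay max_r; [apply/andP; split; lra|lra].
Qed.

(* Let [q s = - (2 * v / theta) * (1 - s / theta)] be the acceleration of the optimal
   braking; then [eta' ^+ 2 >= 2 * q * eta' - q ^+ 2], whose right-hand side has the
   primitive [h] because [xi' = eta]. *)
Lemma braking_energy T theta xi eta x0 v x : 0 < T -> 0 < theta <= T ->
  Gamma T (xi, eta) -> xi 0 = x0 -> eta 0 = v -> v * theta = 3 * (x - x0) ->
  v * (xi theta - x) <= 0 ->
  mu.-integrable `[0, T] (EFin \o (fun s => derive1 eta s ^+ 2)) ->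
  4 / 3 * (v ^+ 2 / theta) <= \int[mu]_(s in `[0, theta]) (derive1 eta s ^+ 2).
Proof.
move=> T0 /andP[t0 tT] [_ /= aceta H] xi0 eta0 vt vx eta2.
pose u s := 1 - s / theta.
pose k := - (4 * v / theta).
pose c := 4 / 3 * (v ^+ 2 / theta).
pose h := k \*: (u * eta + theta^-1 \*: xi) + c \*: u ^+ 3.
have hE s : h s = k * (u s * eta s + theta^-1 * xi s) + c * u s ^+ 3 by [].
apply: (@le_trans _ _ (h theta - h 0)).
  rewrite !hE /u divff ?gt_eqF// mul0r subr0 subrr xi0 eta0.
  (* Only the position at [theta] is left besides [c], and it contributes with the right sign
     because the curve cannot pass beyond [x]. *)
  rewrite (_ : _ - _ = c - 4 / theta ^+ 2 * (v * (xi theta - x))).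
    by rewrite lerDl oppr_ge0 mulr_ge0_le0// divr_ge0// sqr_ge0.
  have -> : x = x0 + v * theta / 3 by rewrite vt; field.
  by rewrite /k /c; field; rewrite gt_eqF.
have ac' : abs_continuous 0 theta eta by apply: abs_continuousS aceta.
have [M M0 etaM] := within_bounded (ltW T0) (abs_continuous_within (ltW T0) aceta).
apply: increment_le_integral; first exact: ltW.
(* [B] collects the Lipschitz constants: [xi] has the derivative [eta], bounded by [M], and [u]
   takes values in [[0, 1]] with slope [- theta^-1]. *)
- pose B := `|k| * (2 * (theta^-1 * M)) + `|c| * (3 * theta^-1).
  apply: (@abs_continuous_le _ _ _ eta h `|k| B) => //.
    by rewrite addr_ge0// !mulr_ge0// invr_ge0 ltW.
  move=> y z y0 yz zt.
  have [r rin xiE] := @derive_within_MVT _ 0 T xi eta y z (fun s sT => (H s sT).1)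
    y0 yz (le_trans zt tT).
  have yz0 : 0 <= z - y by rewrite subr_ge0.
  have rT : 0 <= r <= T by move: rin => /andP[? ?]; apply/andP; split; lra.
  have yT : 0 <= y <= T by apply/andP; split; lra.
  have u01 s : 0 <= s -> s <= theta -> 0 <= u s <= 1.
    move=> s0 st; rewrite /u subr_ge0 ler_pdivrMr// mul1r st/=.
    by rewrite gerBl divr_ge0// ltW.
  have [uz0 uz1] : 0 <= u z /\ u z <= 1 by apply/andP/u01 => //; lra.
  have [uy0 uy1] : 0 <= u y /\ u y <= 1 by apply/andP/u01 => //; lra.
  have uzy : u z - u y = - (theta^-1 * (z - y)) by rewrite /u; ring.
  rewrite !hE (_ : _ - _ = k * (u z * (eta z - eta y) + (theta^-1 * (z - y)) *
      (eta r - eta y)) + c * ((u z - u y) * (u z ^+ 2 + u z * u y + u y ^+ 2))).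
    rewrite uzy.
    apply: le_trans (ler_normD _ _) _; rewrite !(normrM k) !(normrM c).
    rewrite [leRHS](_ : _ = `|k| * (`|eta z - eta y| + 2 * (theta^-1 * M) * (z - y))
      + `|c| * (3 * theta^-1 * (z - y))); last by rewrite /B; ring.
    apply: lerD.
      rewrite ler_wpM2l//.
      apply: le_trans (ler_normD _ _) _; apply: lerD.
        by rewrite normrM (ger0_norm uz0) ler_piMl.
      rewrite normrM [leRHS](_ : _ = theta^-1 * (z - y) * (M + M)); last by ring.
      rewrite ger0_norm; last by rewrite mulr_ge0// invr_ge0 ltW.
      rewrite ler_wpM2l//; first by rewrite mulr_ge0// invr_ge0 ltW.
      by apply: le_trans (ler_normB _ _) _; apply: lerD; exact: etaM.
    rewrite ler_wpM2l// mulNr normrN.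
    rewrite (_ : 3 * _ * _ = theta^-1 * (z - y) * 3); last by ring.
    have T1 : 0 <= theta^-1 * (z - y) by rewrite mulr_ge0// invr_ge0 ltW.
    have S0 : 0 <= u z ^+ 2 + u z * u y + u y ^+ 2.
      by rewrite !addr_ge0// ?sqr_ge0// mulr_ge0.
    rewrite ger0_norm; last exact: mulr_ge0.
    apply: ler_wpM2l => //.
    have := mulr_ile1 uz0 uy0 uz1 uy1.
    have := exprn_ile1 2 uz0 uz1; have := exprn_ile1 2 uy0 uy1; lra.
  have -> : xi z = xi y + eta r * (z - y) by rewrite -xiE; ring.
  by rewrite /u; ring.
- apply: integrableS eta2 => //; by apply: subset_itv; rewrite bnd_simp.
have := abs_continuous_is_derive (ltW t0) ac'.
apply: filterS; first exact: (ae_filter_ringOfSetsType mu).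
move=> s H' /andP[s0 st]; have {}H' := H' ltac:(by rewrite s0 st).
have dxi : is_derive s 1 xi (eta s).
  apply: (@derive_within_is_derive _ 0 T); first by apply/andP; split; lra.
  by apply: (H s _).1; rewrite in_itv/=; apply/andP; split; lra.
have du : is_derive s 1 u (- theta^-1).
  have d := is_deriveB (is_derive_cst (1 : R) s 1)
    (is_deriveZ theta^-1 (is_derive_id s (1 : R))).
  have -> : u = cst 1 - theta^-1 \*: (id : R -> R).
    by apply/funext => y; rewrite /u mulrC.
  by apply: is_derive_eq d _; rewrite /GRing.scale/= mulr1 sub0r.
(* [k / 2 * u s] is the optimal acceleration [q s]; in the derivative of [h] the two terms in
   [eta s] cancel. *)
exists (2 * (k / 2 * u s) * derive1 eta s - (k / 2 * u s) ^+ 2); last first.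
  have := sqr_ge0 (derive1 eta s - k / 2 * u s); nra.
have d := is_deriveD (is_deriveZ k (is_deriveD (is_deriveM du H')
   (is_deriveZ theta^-1 dxi))) (is_deriveZ c (is_deriveX 3 du)).
apply: is_derive_eq d _.
rewrite /GRing.scale/= /k /c.
by field; rewrite gt_eqF.
Qed.

Lemma energy_bound_after T theta eta K : 0 <= theta <= T ->
  abs_continuous 0 T eta ->
  mu.-integrable `[0, T] (EFin \o (fun s => derive1 eta s ^+ 2)) ->
  K <= \int[mu]_(s in `[0, theta]) (derive1 eta s ^+ 2) ->
  energy_bound theta T eta (\int[mu]_(s in `[0, T]) (derive1 eta s ^+ 2) - K).
Proof.
move=> /andP[t0 tT] ac eta2 KE n l r lr.
have eta2S c d : 0 <= c -> d <= T ->
    mu.-integrable `[c, d] (EFin \o (fun x => derive1 eta x ^+ 2)).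
  by move=> ac' db; apply: integrableS eta2 => //; apply: subset_itv; rewrite bnd_simp.
have E := abs_continuous_energy_bound tT (abs_continuousS t0 (lexx T) ac)
  (eta2S _ _ t0 (lexx _)) lr.
apply: le_trans E _.
have := @Rintegral_itvB _ (fun x => derive1 eta x ^+ 2) (BLeft 0) (BRight T) theta eta2.
rewrite !bnd_simp => /(_ t0 tT).
rewrite Rintegral_itv_obnd_cbnd => [|]; last first.
  apply: integrableS (eta2S _ _ t0 (lexx T)) => //.
  by apply: subset_itv; rewrite bnd_simp.
lra.
Qed.

End competitor_curves.

(** * Choice of the braking parameters *)

Section approximation.
Context {R : realType}.
Implicit Types (x v X V e k theta : R).

(* The competitor is [1 - k] times a given curve from [(x, v)] plus [k] times a braking
   curve from a point [(Y / k, w / k)]. *)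
Definition mild_braking e x v X V := exists k theta : R,
  let Y := k * x + (X - x) in let w := k * v + (V - v) in
  [/\ 0 <= k <= Num.min 1 e, 0 < theta, - k <= Y <= 0,
      - k <= Y + w * theta / 3 <= 0 & `|w| <= e /\ w ^+ 2 / theta <= e].

(** The equation makes the brake stop exactly at [x]. For [V != 0] the last condition says that [x]
    is the endpoint of [[-1, 0]] towards which [V] points, as the lower bound [braking_energy]
    requires. *)
Definition hard_braking e x v X V := v = 0 /\ exists theta : R,
  [/\ 0 < theta <= e, V * theta = 3 * (x - X) &
    forall y, -1 <= y <= 0 -> V * (y - x) <= 0].

Lemma Xi_adE x v : Xi_ad R (x, v) <->
  [/\ -1 <= x <= 0, x = 0 -> v <= 0 & x = -1 -> 0 <= v].
Proof.
split=> [[/XiE x10 H]|[x10 H1 H2]].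
  split => // xE; rewrite leNgt; apply/negP => v0; apply: H; [left|right]; split => //=;
    by rewrite in_itv/= v0.
split; first exact/XiE.
move=> [[/= x0]|[/= x1]]; rewrite in_itv/= ?andbT => v0.
  by have := H1 x0; rewrite leNgt v0.
by have := H2 x1; rewrite leNgt v0.
Qed.

Lemma Xi_ad_sym x v : Xi_ad R (x, v) -> Xi_ad R (- 1 - x, - v).
Proof.
move=> /Xi_adE[x10 H1 H2]; apply/Xi_adE; split=> [|xE|xE].
- by move: x10 => /andP[? ?]; apply/andP; split; lra.
- by have := H2 ltac:(lra); lra.
- by have := H1 ltac:(lra); lra.
Qed.

(* The reflection [(x, v) |-> (- 1 - x, - v)] exchanges the two endpoints. *)
Lemma mild_braking_sym e x v X V :
  mild_braking e (- 1 - x) (- v) (- 1 - X) (- V) -> mild_braking e x v X V.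
Proof.
move=> [k [theta /= [k01 t0 Y1 Y2 [w1 w2]]]]; exists k, theta => /=.
have wE : k * - v + (- V - - v) = - (k * v + (V - v)) by ring.
rewrite wE normrN sqrrN in w1 w2; rewrite wE in Y2.
split => //.
- by move: Y1 => /andP[? ?]; apply/andP; split; lra.
- by move: Y2 => /andP[? ?]; apply/andP; split; lra.
Qed.

Lemma hard_braking_sym e x v X V :
  hard_braking e (- 1 - x) (- v) (- 1 - X) (- V) -> hard_braking e x v X V.
Proof.
move=> [v0 [theta [t1 t2 H]]]; split; first by lra.
exists theta; split=> [//||y /andP[y1 y2]]; first by lra.
by have := H (- 1 - y) ltac:(apply/andP; split; lra); lra.
Qed.

(** With [theta] fixed first, [k * M] is taken as a number [m <= 1] below [e * theta], whence
    [m ^+ 2 <= m <= e * theta]. *)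
Lemma small_weight e theta M : 0 < e -> 0 < theta -> 1 <= M ->
  exists k, [/\ 0 < k, k <= Num.min 1 e, k * M <= e & (k * M) ^+ 2 / theta <= e].
Proof.
move=> e0 t0 M1; have M0 : 0 < M by lra.
pose m := Num.min 1 (Num.min e (e * theta)).
have m0 : 0 < m by rewrite !lt_min ltr01 e0 mulr_gt0.
have m1 : m <= 1 by rewrite ge_min lexx.
have me : m <= e by rewrite !ge_min lexx !orbT.
have met : m <= e * theta by rewrite !ge_min lexx !orbT.
exists (m / M); rewrite divfK ?gt_eqF//.
have mM : m / M <= m by rewrite ler_pdivrMr// ler_peMr// ltW.
split => //; first by rewrite divr_gt0.
  by rewrite le_min !(le_trans mM).
by rewrite ler_pdivrMr//; apply: le_trans met; rewrite expr2 ler_piMl// ltW.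
Qed.

(** Let [m] be the distance to the boundary. The start deviates from [k * x] by at most [k * m / 3],
    and as [|w| <= k * (|v| + 1)] the brake adds at most another [k * m / 3], so everything stays in
    [[-k, 0]]. *)
Lemma braking_interior x v e : -1 < x < 0 -> 0 < e ->
  exists2 d, 0 < d & forall X V, `|X - x| < d -> `|V - v| < d ->
    mild_braking e x v X V.
Proof.
move=> /andP[x1 x0] e0.
pose m := Num.min (- x) (1 + x).
have m0 : 0 < m by rewrite lt_min; apply/andP; split; lra.
have mx : m <= - x by rewrite ge_min lexx.
have mx1 : m <= 1 + x by rewrite ge_min lexx orbT.
have M1 : 1 <= `|v| + 1 by rewrite lerDr.
have M0 : 0 < `|v| + 1 by lra.
have th0 : 0 < m / (`|v| + 1) by rewrite divr_gt0.
have [k [k0 k1 kM kM2]] := small_weight e0 th0 M1.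
have km : 0 < k * m by rewrite mulr_gt0.
have kmk : k * m <= k by rewrite ger_pMr//; lra.
exists (k * m / 3); first by rewrite divr_gt0.
move=> X V Xx Vv; exists k, (m / (`|v| + 1)) => /=.
set w := k * v + (V - v).
have wM : `|w| <= k * (`|v| + 1).
  apply: le_trans (ler_normD _ _) _; rewrite normrM (gtr0_norm k0) mulrDr mulr1 lerD2l.
  lra.
have wt : `|w * (m / (`|v| + 1))| <= k * m.
  rewrite normrM (gtr0_norm th0) mulrA ler_pdivrMr// mulrAC ler_pM2r//.
move: Xx wt; rewrite ltr_norml ler_norml => /andP[? ?] /andP[? ?].
have kx1 : k * m <= k * - x by rewrite ler_pM2l.
have kx2 : k * m <= k * (1 + x) by rewrite ler_pM2l.
split => //; first by rewrite (ltW k0).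
- by apply/andP; split; lra.
- by apply/andP; split; lra.
split; first exact: le_trans kM.
apply: le_trans kM2; rewrite ler_pM2r ?invr_gt0//.
by rewrite -(real_normK (num_real w)) lerXn2r ?nnegrE ?normr_ge0// mulr_ge0// ltW.
Qed.

(** [|V - v| < k * - v] forces [w <= 0]: the braking curve moves into the strip, by at most [k / 3],
    from a start at a distance at most [k / 3] from 0. *)
Lemma braking_leaving v e : v < 0 -> 0 < e ->
  exists2 d, 0 < d & forall X V, Xi_ad R (X, V) -> `|X - 0| < d -> `|V - v| < d ->
    mild_braking e 0 v X V.
Proof.
move=> v0 e0.
have M1 : 1 <= `|v| + 1 by rewrite lerDr.
have M0 : 0 < `|v| + 1 by lra.
have th0 : 0 < 1 / (`|v| + 1) by rewrite divr_gt0.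
have [k [k0 k1 kM kM2]] := small_weight e0 th0 M1.
have kv0 : 0 < k * - v by rewrite mulr_gt0// oppr_gt0.
exists (Num.min (k / 3) (k * - v)); first by rewrite lt_min kv0 andbT divr_gt0.
move=> X V /Xi_adE[/andP[X1 X0] _ _]; rewrite !lt_min => /andP[Xk _] /andP[Vk Vv].
exists k, (1 / (`|v| + 1)) => /=; set w := k * v + (V - v).
have w0 : w <= 0 by move: Vv; rewrite ltr_norml /w => /andP[? ?]; lra.
have wM : `|w| <= k * (`|v| + 1).
  apply: le_trans (ler_normD _ _) _; rewrite normrM (gtr0_norm k0) mulrDr mulr1 lerD2l.
  lra.
have wt : `|w * (1 / (`|v| + 1))| <= k.
  by rewrite normrM (gtr0_norm th0) mulrA ler_pdivrMr// mulr1.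
have wt0 : w * (1 / (`|v| + 1)) <= 0 by rewrite mulr_le0_ge0// ltW.
move: Xk wt; rewrite ltr_norml ler_norml => /andP[? ?] /andP[? ?].
split => //; first by rewrite (ltW k0).
- by apply/andP; split; lra.
- by apply/andP; split; lra.
split; first exact: le_trans kM.
apply: le_trans kM2; rewrite ler_pM2r ?invr_gt0//.
by rewrite -(real_normK (num_real w)) lerXn2r ?nnegrE ?normr_ge0// mulr_ge0// ltW.
Qed.

(** If [V <= 0], brake during a unit time. If [V > 0], then [X < 0], and [3 * - X / V] is the
    longest stopping time that does not overshoot 0. Either [V ^+ 2] is at most [e] times it and the
    braking is mild, or it is less than [V ^+ 2 / e], hence small, and the braking is hard. *)
Lemma braking_corner e : 0 < e ->
  exists2 d, 0 < d & forall X V, Xi_ad R (X, V) -> `|X - 0| < d -> `|V - 0| < d ->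
    mild_braking e 0 0 X V \/ hard_braking e 0 0 X V.
Proof.
move=> e0; have [k [k0 k1 _ k2]] := small_weight e0 ltr01 (lexx 1).
rewrite mulr1 divr1 in k2.
have ke : k <= e by apply: le_trans k1 _; rewrite ge_min lexx orbT.
have k1' : k <= 1 by apply: le_trans k1 _; rewrite ge_min lexx.
exists (Num.min (k / 2) (e / 2)); first by rewrite lt_min !divr_gt0.
move=> X V /Xi_adE[/andP[X1 X0] XV _]; rewrite !subr0 !lt_min.
move=> /andP[Xk Xe] /andP[Vk Ve].
have V2 : V ^+ 2 <= e.
  apply: le_trans k2; rewrite -(real_normK (num_real V)).
  by rewrite lerXn2r ?nnegrE ?normr_ge0 ?(ltW k0)//; lra.
move: (Xk) (Vk); rewrite !ltr_norml => /andP[? ?] /andP[? ?].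
have [V0|V0] := leP V 0.
  left; exists k, 1 => /=; rewrite !mulr0 !add0r !subr0 mulr1 divr1.
  split => //; [by rewrite (ltW k0)|by apply/andP; split; lra|by apply/andP; split; lra|].
  by split => //; lra.
have {}X0 : X < 0.
  rewrite lt_neqAle X0 andbT; apply/eqP => X0'; have := XV X0'.
  by rewrite leNgt V0.
have th0 : 0 < 3 * - X / V by rewrite divr_gt0// mulr_gt0// oppr_gt0.
have VX : V * (3 * - X / V) = 3 * - X by rewrite mulrC divfK// gt_eqF.
have [Vt|tV] := leP (V ^+ 2) (e * (3 * - X / V)).
  left; pose th := Num.min 1 (3 * - X / V).
  have tp : 0 < th by rewrite lt_min ltr01.
  have t1 : th <= 3 * - X / V by rewrite ge_min lexx orbT.
  have Vth : 0 <= V * th <= 3 * - X.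
    by rewrite mulr_ge0 ?(ltW V0) ?(ltW tp)//= -VX ler_pM2l.
  exists k, th => /=; rewrite !mulr0 !add0r !subr0.
  move: Vth => /andP[? ?].
  split => //; [by rewrite (ltW k0)|by apply/andP; split; lra|by apply/andP; split; lra|].
  split; first lra.
  rewrite ler_pdivrMr// /th /Num.min; case: ifP => // _; by rewrite mulr1.
right; split => //; exists (3 * - X / V); split.
- rewrite th0/=; rewrite mulrC -ltr_pdivlMr// in tV; apply/ltW/(lt_le_trans tV).
  rewrite ler_pdivrMr// expr2; apply: ler_pM; rewrite ?(ltW V0)//; lra.
- by rewrite VX sub0r.
- by move=> y /andP[_ y0]; rewrite subr0 mulr_ge0_le0// ltW.
Qed.

Lemma braking_alternatives x v e : Xi_ad R (x, v) -> 0 < e ->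
  exists2 d, 0 < d & forall X V, Xi_ad R (X, V) -> `|X - x| < d -> `|V - v| < d ->
    mild_braking e x v X V \/ hard_braking e x v X V.
Proof.
have right_end w : w <= 0 -> 0 < e ->
    exists2 d, 0 < d & forall X V, Xi_ad R (X, V) -> `|X - 0| < d -> `|V - w| < d ->
    mild_braking e 0 w X V \/ hard_braking e 0 w X V.
  rewrite le_eqVlt => /predU1P[-> /braking_corner//|w0 e0].
  have [d d0 H] := braking_leaving w0 e0; exists d => // X V *.
  by left; exact: H.
move=> /[dup] xv /Xi_adE[/andP[x1 x0] v0 v1] e0.
have [xE|xn0] := eqVneq x 0; first by rewrite xE; apply: right_end => //; exact: v0.
have [xE|xn1] := eqVneq x (-1).
  have [|d d0 H] := right_end (- v) _ e0; first by rewrite oppr_le0 v1.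
  exists d => // X V /Xi_ad_sym XV; rewrite xE => Xd Vd.
  have [||?|?] := H _ _ XV.
  - by rewrite (_ : _ - 0 = - (X - -1)) ?normrN//; ring.
  - by rewrite (_ : _ - _ = - (V - v)) ?normrN//; ring.
  - by left; apply: mild_braking_sym; rewrite opprK addNr.
  - by right; apply: hard_braking_sym; rewrite opprK addNr.
have [|d d0 H] := @braking_interior x v e _ e0.
  by rewrite !lt_neqAle x1 x0 xn0 eq_sym xn1.
by exists d => // X V _ Xd Vd; left; exact: H.
Qed.

(** Makes plain braking from [(x, v)] admissible, which provides a first comparison curve of finite
    energy. *)
Lemma braking_exists x v : Xi_ad R (x, v) ->
  exists2 theta, 0 < theta & -1 <= x + v * theta / 3 <= 0.
Proof.
move=> /Xi_adE[/andP[x1 x0] v0 v1].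
have M1 : 0 < `|v| + 1 by rewrite ltr_wpDl.
have vM : `|v| / (`|v| + 1) <= 1 by rewrite ler_pdivrMr// mul1r lerDl.
have step c : 0 < c -> - c <= v * (c / (`|v| + 1)) <= c.
  move=> c0; rewrite -ler_norml normrM (gtr0_norm (divr_gt0 c0 M1)).
  by rewrite mulrCA ger_pMr.
have th0 : 0 < (`|v| + 1)^-1 by rewrite invr_gt0.
have [xE|xn0] := eqVneq x 0.
  exists (1 / (`|v| + 1)); first by rewrite mul1r.
  have /andP[? ?] := step _ ltr01; have ? := v0 xE.
  have : v * (1 / (`|v| + 1)) <= 0 by rewrite mulr_le0_ge0// mul1r ltW.
  by move=> ?; rewrite xE; apply/andP; split; lra.
have [xE|xn1] := eqVneq x (-1).
  exists (1 / (`|v| + 1)); first by rewrite mul1r.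
  have /andP[? ?] := step _ ltr01; have ? := v1 xE.
  have : 0 <= v * (1 / (`|v| + 1)) by rewrite mulr_ge0// mul1r ltW.
  by move=> ?; rewrite xE; apply/andP; split; lra.
pose m := Num.min (- x) (1 + x).
have m0 : 0 < m.
  rewrite lt_min oppr_gt0 lt_neqAle xn0 x0/=.
  by rewrite -subr_gt0 subr0 -ltrBlDl sub0r lt_neqAle eq_sym xn1.
have mx : m <= - x by rewrite ge_min lexx.
have mx1 : m <= 1 + x by rewrite ge_min lexx orbT.
exists (m / (`|v| + 1)); first by rewrite divr_gt0.
by have /andP[? ?] := step _ m0; apply/andP; split; lra.
Qed.

End approximation.

(** * Continuity of the cost *)

Section cost.
Context {R : realType}.
Notation mu := (@lebesgue_measure R).
Variables (T : R) (ell : R * R * R -> R) (g : R * R -> R).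
Hypotheses (T_gt0 : 0 < T)
  (ell_cont : {within Xi R `*` `[0, T]%classic, continuous ell})
  (g_cont : {within Xi R, continuous g}).
Implicit Types (xi eta : R -> R) (e C : R).

Let T_ge0 : 0 <= T := ltW T_gt0.

Lemma running_cost_local x v t e : -1 <= x <= 0 -> 0 <= t <= T -> 0 < e ->
  exists2 d, 0 < d & forall y w s, -1 <= y <= 0 -> 0 <= s <= T ->
    `|y - x| < d -> `|w - v| < d -> `|s - t| < d ->
    `|ell (y, w, s) - ell (x, v, t)| <= e.
Proof.
move=> x10 tT e0.
have D0 : (Xi R `*` `[0, T]%classic) (x, v, t).
  by split; [exact/XiE|rewrite /= in_itv].
have /subspace_continuousP/(_ _ D0)/cvgrPdist_le/(_ _ e0) := ell_cont.
rewrite near_withinE => /nbhs_ballP[d /= d0 H]; exists d => // y w s y10 sT yd wd sd.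
rewrite distrC; apply: (H (y, w, s)); last first.
  by split; [exact/XiE|rewrite /= in_itv].
by split; [split|]; rewrite /ball /= distrC.
Qed.

Lemma final_cost_local x v e : -1 <= x <= 0 -> 0 < e ->
  exists2 d, 0 < d & forall y w, -1 <= y <= 0 ->
    `|y - x| < d -> `|w - v| < d -> `|g (y, w) - g (x, v)| <= e.
Proof.
move=> x10 e0; have D0 : Xi R (x, v) by exact/XiE.
have /subspace_continuousP/(_ _ D0)/cvgrPdist_le/(_ _ e0) := g_cont.
rewrite near_withinE => /nbhs_ballP[d /= d0 H]; exists d => // y w y10 yd wd.
rewrite distrC; apply: (H (y, w)); last exact/XiE.
by split; rewrite /ball /= distrC.
Qed.

Definition in_strip xi := forall s, 0 <= s <= T -> -1 <= xi s <= 0.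

Let dist_lt (a b c r d : R) : `|a - b| <= r -> r < d / 2 ->
  `|b - c| <= d / 2 / 2 -> `|a - c| < d.
Proof.
move=> ab rd bc; apply: le_lt_trans (ler_distD b a c) _.
have := normr_ge0 (b - c); lra.
Qed.

Let quarter_lt (d : R) : 0 < d -> d / 2 / 2 < d.
Proof. lra. Qed.

Let half_lt (d : R) : 0 < d -> d / 2 < d.
Proof. lra. Qed.

(** [Xi] is not compact, but [[0, T]] is: the local moduli of [ell] along the curve are made uniform
    by the near-covering form of compactness. *)
Lemma running_cost_uniform xi eta e :
  {within `[0, T], continuous xi} -> {within `[0, T], continuous eta} ->
  in_strip xi -> 0 < e ->
  exists2 d, 0 < d & forall s y w, 0 <= s <= T -> -1 <= y <= 0 ->
    `|y - xi s| <= d -> `|w - eta s| <= d ->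
    `|ell (y, w, s) - ell (xi s, eta s, s)| <= e.
Proof.
move=> /within_continuousP cxi /within_continuousP ceta xiX e0.
pose P d s := 0 <= s <= T -> forall y w, -1 <= y <= 0 ->
    `|y - xi s| <= d -> `|w - eta s| <= d ->
    `|ell (y, w, s) - ell (xi s, eta s, s)| <= e.
have : \forall d \near 0^'+, `[0, T]%classic `<=` P d.
  apply: (iffLR (compact_near_coveringP _) (@segment_compact R 0 T)).
  move=> t; rewrite /= in_itv/= => tT.
  have t01 : `[0, T]%classic t by rewrite /= in_itv.
  have e2 : 0 < e / 2 by rewrite divr_gt0.
  have [d d0 H] := running_cost_local (eta t) (xiX _ tT) tT e2.
  have d2 : 0 < d / 2 / 2 by rewrite !divr_gt0.
  have [d1 d10 H1] := cxi _ t01 _ d2; have [d3 d30 H3] := ceta _ t01 _ d2.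
  exists (ball t (Num.min d (Num.min d1 d3)), [set r | r < d / 2]).
    split => /=; first by apply: nbhsx_ballx; rewrite !lt_min d0 d10.
    by apply: nbhs_right_lt; rewrite divr_gt0.
  move=> [s r] [/=]; rewrite /ball/= distrC !lt_min => /andP[sd /andP[s1 s3]].
  move=> rd sT y w y10 yr wr.
  have s01 : `[0, T]%classic s by rewrite /= in_itv.
  have X1 := H1 s s01 s1; have X3 := H3 s s01 s3.
  have E1 := H y w s y10 sT (dist_lt yr rd X1) (dist_lt wr rd X3) sd.
  have E2 : `|ell (xi s, eta s, s) - ell (xi t, eta t, t)| <= e / 2.
    apply: H => //; first exact: xiX.
      exact: le_lt_trans X1 (quarter_lt d0).
    exact: le_lt_trans X3 (quarter_lt d0).
  apply: le_trans (ler_distD (ell (xi t, eta t, t)) _ _) _.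
  by rewrite [leRHS]splitr lerD// distrC.
move=> /(filterI (nbhs_right_gt (0 : R)))/filter_ex[d [/= d0 H]].
by exists d => // s y w sT; apply: H.
Qed.

Lemma running_cost_continuous xi eta :
  {within `[0, T], continuous xi} -> {within `[0, T], continuous eta} ->
  in_strip xi -> {within `[0, T], continuous (fun s => ell (xi s, eta s, s))}.
Proof.
move=> /within_continuousP cxi /within_continuousP ceta xiX.
apply/within_continuousP => t t01 e e0.
have tT : 0 <= t <= T by move: t01; rewrite /= in_itv.
have [d d0 H] := running_cost_local (eta t) (xiX _ tT) tT e0.
have d2 : 0 < d / 2 by rewrite divr_gt0.
have [d1 d10 H1] := cxi _ t01 _ d2; have [d3 d30 H3] := ceta _ t01 _ d2.
exists (Num.min d (Num.min d1 d3)); first by rewrite !lt_min d0 d10.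
move=> s s01; rewrite !lt_min => /andP[sd /andP[s1 s3]].
have sT : 0 <= s <= T by move: s01; rewrite /= in_itv.
apply: H => //; first exact: xiX.
  exact: le_lt_trans (H1 s s01 s1) (half_lt d0).
exact: le_lt_trans (H3 s s01 s3) (half_lt d0).
Qed.

Definition running_cost xi eta : R := \int[mu]_(s in `[0, T]) ell (xi s, eta s, s).

Definition energy eta : R := \int[mu]_(s in `[0, T]) (derive1 eta s ^+ 2).

Lemma running_cost_integrable xi eta :
  {within `[0, T], continuous xi} -> {within `[0, T], continuous eta} ->
  in_strip xi ->
  mu.-integrable `[0, T] (EFin \o (fun s => ell (xi s, eta s, s))).
Proof.
move=> cxi ceta xiX; apply: continuous_compact_integrable.
  exact: segment_compact.
exact: running_cost_continuous.
Qed.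

Lemma running_cost_close xi eta e :
  {within `[0, T], continuous xi} -> {within `[0, T], continuous eta} ->
  in_strip xi -> 0 < e ->
  exists2 d, 0 < d & forall xi' eta',
    {within `[0, T], continuous xi'} -> {within `[0, T], continuous eta'} ->
    in_strip xi' ->
    (forall s, 0 <= s <= T -> `|xi' s - xi s| <= d /\ `|eta' s - eta s| <= d) ->
    `|running_cost xi' eta' - running_cost xi eta| <= e /\
    `|g (xi' T, eta' T) - g (xi T, eta T)| <= e.
Proof.
move=> cxi ceta xiX e0.
have eT : 0 < e / T by rewrite divr_gt0.
have [d1 d10 H1] := running_cost_uniform cxi ceta xiX eT.
have TT : 0 <= T <= T by rewrite T_ge0 lexx.
have [d2 d20 H2] := final_cost_local (eta T) (xiX _ TT) e0.
exists (Num.min d1 (d2 / 2)); first by rewrite lt_min d10 divr_gt0.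
move=> xi' eta' cxi' ceta' xiX' close; split; last first.
  have [C1 C2] := close _ TT; move: C1 C2; rewrite !le_min => /andP[_ ?] /andP[_ ?].
  by apply: H2; [exact: xiX'|lra|lra].
have I1 := running_cost_integrable cxi ceta xiX.
have I2 := running_cost_integrable cxi' ceta' xiX'.
have mI : measurable (`[0, T]%classic : set (measurableTypeR R)) by exact: measurable_itv.
pose gap s := ell (xi' s, eta' s, s) - ell (xi s, eta s, s).
have I3 : mu.-integrable `[0, T] (EFin \o gap) := integrableB mI I2 I1.
have -> : running_cost xi' eta' - running_cost xi eta = \int[mu]_(s in `[0, T]) gap s.
  by rewrite /running_cost -RintegralB.
apply: le_trans (le_normr_Rintegral mI I3) _.
apply: (@le_trans _ _ (\int[mu]_(s in `[0, T]) (e / T))).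
  apply: le_Rintegral => //.
  - exact: (integrable_abse I3).
  - apply: continuous_compact_integrable; first exact: segment_compact.
    by apply: continuous_subspaceT => ?; exact: cvg_cst.
  move=> s; rewrite /= in_itv/= => sT; have [C1 C2] := close s sT.
  move: C1 C2; rewrite !le_min => /andP[? _] /andP[? _].
  by apply: H1 => //; exact: xiX'.
rewrite Rintegral_cst//= lebesgue_measure_itv/= lte_fin T_gt0 -EFinB/= subr0.
by rewrite divfK// gt_eqF.
Qed.

Lemma Gamma_in_strip c : Gamma T c -> in_strip c.1.
Proof.
move=> [_ _ H] s sT; apply/(XiE _ (c.2 s)).
by have [|_] := H s; first by rewrite in_itv.
Qed.

Lemma Gamma_continuous c : Gamma T c ->
  {within `[0, T], continuous c.1} /\ {within `[0, T], continuous c.2}.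
Proof.
move=> [_ ac H]; split; last exact: abs_continuous_within.
by apply: (@derive_within_continuous _ _ _ c.2) => s sT; have [] := H s sT.
Qed.

Lemma in_L2P c : Gamma T c -> in_L2 T (derive1 c.2) <->
  mu.-integrable `[0, T] (EFin \o (fun s => derive1 c.2 s ^+ 2)).
Proof.
move=> [_ ac _]; rewrite /in_L2.
have -> : (fun s => (`|derive1 c.2 s| ^+ 2)%:E) =
    EFin \o (fun s => derive1 c.2 s ^+ 2).
  by apply/funext => s /=; rewrite real_normK ?num_real.
by split=> [[]//|H]; split => //; exact: abs_continuous_measurable_derive1.
Qed.

Lemma costE c : Gamma T c ->
  mu.-integrable `[0, T] (EFin \o (fun s => derive1 c.2 s ^+ 2)) ->
  cost T ell g c =
    (running_cost c.1 c.2 + 2^-1 * energy c.2 + g (c.1 T, c.2 T))%:E.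
Proof.
move=> cG E2; rewrite /cost /J asboolT; last exact/in_L2P.
have [c1 c2] := Gamma_continuous cG.
have I1 := running_cost_integrable c1 c2 (Gamma_in_strip cG).
have mI : measurable (`[0, T]%classic : set (measurableTypeR R)) by exact: measurable_itv.
rewrite EFinD; congr (_ + _)%E.
under eq_integral do rewrite real_normK ?num_real// EFinD EFinM.
rewrite integralD//; last exact: integrableZl.
rewrite integralZl// EFinD EFinM /running_cost /energy /Rintegral.
by rewrite !fineK//; exact: integrable_fin_num.
Qed.

Lemma cost_pinfty c : Gamma T c ->
  ~ mu.-integrable `[0, T] (EFin \o (fun s => derive1 c.2 s ^+ 2)) ->
  cost T ell g c = +oo%E.
Proof. by move=> cG E2; rewrite /cost /J asboolF// => /(in_L2P cG). Qed.

End cost.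

(** * Competitors for nearby initial data *)

Section competitor_existence.
Context {R : realType}.
Notation mu := (@lebesgue_measure R).
Implicit Types (T x v X V e C theta : R) (xi eta : R -> R).

Lemma energy_bound_le T theta eta C C' : C <= C' ->
  energy_bound theta T eta C -> energy_bound theta T eta C'.
Proof. by move=> CC H n l r lr; apply: le_trans CC; exact: H. Qed.

Lemma derive_within_MVT_sym a b (f f' : R -> R) x y :
  (forall s, s \in `[a, b] -> derive_within `[a, b] f s (f' s)) ->
  a <= x <= b -> a <= y <= b ->
  exists c, [/\ a <= c <= b, `|c - x| <= `|y - x| & f y - f x = f' c * (y - x)].
Proof.
move=> df /andP[ax xb] /andP[ay yb]; have [xy|/ltW yx] := leP x y.
  have [c /andP[? ?] E] := derive_within_MVT df ax xy yb; exists c; split => //.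
    by apply/andP; split; lra.
  by rewrite !ger0_norm; lra.
have [c /andP[? ?] E] := derive_within_MVT df ay yx xb; exists c; split.
- by apply/andP; split; lra.
- by rewrite !ler0_norm; lra.
- by rewrite -opprB E; ring.
Qed.

Lemma brake_pos0 theta : brake_pos theta 0 = 0.
Proof. by rewrite /brake_pos brake0 expr1n subrr mulr0. Qed.

Lemma delay0 theta : 0 < theta -> delay theta 0 = 0.
Proof. by move=> t0; rewrite /delay max_l// sub0r oppr_le0 ltW. Qed.

Lemma delay_close T theta s : 0 < theta -> 0 <= s <= T ->
  0 <= delay theta s <= T /\ 0 <= s - delay theta s <= theta.
Proof.
move=> t0 /andP[s0 sT]; rewrite /delay /Num.max.
by case: (ltP 0 (s - theta)) => ?; split; apply/andP; split; lra.
Qed.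

(* [K] is the energy which every curve from [(X, V)] spends before [theta]. *)
Definition nearby_competitor T xi eta C e X V (xi' eta' : R -> R) := exists theta K,
  [/\ Gamma_from T (X, V) (xi', eta'),
    forall s, 0 <= s <= T -> `|xi' s - xi s| <= e /\ `|eta' s - eta s| <= e,
    energy_bound 0 T eta' (C + e + K),
    0 <= theta <= e /\ theta <= T &
    forall c, Gamma_from T (X, V) c ->
      mu.-integrable `[0, T] (EFin \o (fun s => derive1 c.2 s ^+ 2)) ->
      energy_bound theta T c.2 (energy T c.2 - K)].

Section fixed_curve.
Variables (T x v : R) (xi eta : R -> R) (C : R).
Hypotheses (T0 : 0 < T) (xieta : Gamma_from T (x, v) (xi, eta))
  (etaC : energy_bound 0 T eta C).

Let adm : admissible T xi eta.
Proof. by case: xieta => -[]. Qed.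

Let xi_strip s : 0 <= s <= T -> -1 <= xi s <= 0.
Proof. by case: xieta => G _ _; exact: (Gamma_in_strip G). Qed.

(** The energy excess is already small here, so nothing has to cancel and [theta = K = 0] in
    [nearby_competitor]. *)
Lemma mild_competitor M k theta w e X V :
  (forall s, 0 <= s <= T -> `|eta s| <= M) -> 0 < e -> 0 < theta ->
  0 <= k <= 1 -> w = k * v + (V - v) ->
  - k <= k * x + (X - x) <= 0 -> - k <= k * x + (X - x) + w * theta / 3 <= 0 ->
  2 * k <= e -> k * M + `|w| <= e ->
  (exists2 m, 0 < m & (1 + m) * C + (1 + m^-1) * (4 / 3 * (w ^+ 2 / theta)) <= C + e) ->
  exists xi' eta', nearby_competitor T xi eta C e X V xi' eta'.
Proof.
move=> etaM e0 t0 /andP[k0 k1] wE Y1 Y2 ke kM [m m0 mC].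
have k01 : 0 <= k <= 1 by rewrite k0 k1.
have k01' : 0 <= 1 - k <= 1 by apply/andP; split; lra.
set Y := k * x + (X - x) in Y1 Y2.
exists (fun s => (1 - k) * xi s + (Y + w * brake_pos theta s)).
exists (fun s => (1 - k) * eta s + w * brake theta s ^+ 2).
have E' := energy_bound_combination w t0 (ltW T0) k01' m0 etaC.
have [_ /= xi0 eta0] := xieta.
exists 0, 0; split.
- split.
  + apply: energy_bound_Gamma E' => //; exact: admissible_combination.
  + by rewrite /= brake_pos0 xi0 /Y; ring.
  + by rewrite /= brake0 eta0 expr1n wE; ring.
- move=> s sT; have [s0 _] := andP sT; split.
    have [t /andP[t1 t2] ->] := brake_pos_itv t0 s0.
    have -> : (1 - k) * xi s + (Y + w * (theta / 3 * t)) - xi s =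
      (1 - t) * Y + t * (Y + w * theta / 3) - k * xi s by ring.
    set Z := Y + w * theta / 3 in Y2 *.
    have := xi_strip sT; move: Y1 Y2 => /andP[? ?] /andP[? ?] /andP[? ?].
    by rewrite ler_norml; apply/andP; split; nra.
  have -> : (1 - k) * eta s + w * brake theta s ^+ 2 - eta s =
    w * brake theta s ^+ 2 - k * eta s by ring.
  apply: le_trans (ler_normB _ _) _; apply: le_trans kM; rewrite addrC.
  apply: lerD; first by rewrite normrM (ger0_norm k0) ler_wpM2l// etaM.
  rewrite normrM ler_piMr// ger0_norm ?sqr_ge0// exprn_ile1 ?brake_ge0//.
  exact: brake_le1.
- by rewrite addr0; exact: energy_bound_le E'.
- by rewrite lexx (ltW e0) (ltW T0).
move=> c [[_ ac _] _ _] E2; rewrite subr0.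
exact: abs_continuous_energy_bound (ltW T0) ac E2.
Qed.

(** [K] is the braking energy: [energy_bound_delay] adds it to the competitor, and [braking_energy]
    shows that every curve from [(X, V)] spends at least as much before [theta]. The bounds by
    [e / 2] control the initial gap, the initial velocity and the effect of the delay. *)
Lemma hard_competitor M theta e X V :
  (forall s, 0 <= s <= T -> `|eta s| <= M) -> 0 < theta <= e -> theta <= T ->
  v = 0 -> -1 <= X <= 0 -> V * theta = 3 * (x - X) ->
  (forall y, -1 <= y <= 0 -> V * (y - x) <= 0) ->
  (forall r s, 0 <= r -> r <= s -> s <= T -> s - r <= theta -> `|eta s - eta r| <= e / 2) ->
  `|X - x| <= e / 2 -> `|V| <= e / 2 -> theta * M <= e / 2 ->
  exists xi' eta', nearby_competitor T xi eta C e X V xi' eta'.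
Proof.
move=> etaM /andP[t0 te] tT v0 X10 Vt Vx etau Xe Ve tM.
have e0 : 0 < e := lt_le_trans t0 te.
exists (fun s => ((X - x) + V * brake_pos theta s) + xi (delay theta s)).
exists (fun s => eta (delay theta s) + V * brake theta s ^+ 2).
have [_ /= xi0 eta0] := xieta.
have E' := energy_bound_delay V t0 (ltW T0) etaC.
have AV : (X - x) + V * theta / 3 = 0 by rewrite Vt; field.
exists theta, (4 / 3 * (V ^+ 2 / theta)); split.
- split.
  + apply: energy_bound_Gamma E' => //.
    apply: (admissible_delay (x := x)) => //; [exact: ltW|by rewrite eta0|].
    by rewrite addrC subrK.
  + by rewrite /= brake_pos0 delay0// xi0; ring.
  + by rewrite /= brake0 delay0// eta0 v0 expr1n; ring.
- move=> s sT; have [s0 s1] := andP sT.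
  have [dT /andP[d0 d1]] := delay_close t0 sT; split.
    have [c [cT _ cE]] := derive_within_MVT_sym (fun s sT => (adm sT).1) sT dT.
    have [t /andP[t1 t2] ->] := brake_pos_itv t0 s0.
    have -> : X - x + V * (theta / 3 * t) + xi (delay theta s) - xi s =
      (1 - t) * (X - x) + t * (X - x + V * theta / 3) +
        (xi (delay theta s) - xi s) by ring.
    rewrite AV mulr0 addr0 cE; apply: le_trans (ler_normD _ _) _.
    have N1 : `|(1 - t) * (X - x)| <= e / 2.
      apply: le_trans Xe; rewrite normrM ger0_norm ?subr_ge0// ler_piMl//.
      by rewrite gerBl.
    have N2 : `|eta c * (delay theta s - s)| <= e / 2.
      apply: le_trans tM; rewrite normrM mulrC; apply: ler_pM => //; last exact: etaM.
      by rewrite distrC ger0_norm.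
    by lra.
  rewrite -addrA (addrC (V * _)) addrA; apply: le_trans (ler_normD _ _) _.
  have N1 : `|eta (delay theta s) - eta s| <= e / 2.
    by rewrite distrC; apply: etau => //; move: dT => /andP[? ?]; lra.
  have N2 : `|V * brake theta s ^+ 2| <= e / 2.
    apply: le_trans Ve; rewrite normrM ler_piMr// ger0_norm ?sqr_ge0//.
    by rewrite exprn_ile1 ?brake_ge0// brake_le1.
  by lra.
- by apply: energy_bound_le E'; rewrite lerD2r lerDl ltW.
- by rewrite (ltW t0) te tT.
move=> c [cG c10 c20] E2; have [_ ac _] := cG.
apply: energy_bound_after => //; first by rewrite (ltW t0) tT.
case: c cG c10 c20 E2 ac => c1 c2 cG /= c10 c20 E2 ac.
apply: (braking_energy T0 _ cG c10 c20 Vt _ E2); first by rewrite t0 tT.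
by apply/Vx/(Gamma_in_strip cG); rewrite (ltW t0) tT.
Qed.

Lemma nearby_competitor_exists e : Xi_ad R (x, v) -> 0 < e ->
  exists2 d, 0 < d & forall X V, Xi_ad R (X, V) -> `|X - x| < d -> `|V - v| < d ->
    exists xi' eta', nearby_competitor T xi eta C e X V xi' eta'.
Proof.
move=> xv e0; have C0 := energy_bound_ge0 etaC.
have aceta := energy_bound_abs_continuous etaC.
have [M M0 etaM] := within_bounded (ltW T0) (abs_continuous_within (ltW T0) aceta).
have e2 : 0 < e / 2 by rewrite divr_gt0.
have [del del0 Hdel] := abs_continuous_seq aceta e2.
(* The parameter of Young's inequality: multiplying [C] by [1 + m] costs at most [e / 2]. *)
have [m m0 mC] : exists2 m, 0 < m & m * C <= e / 2.
  exists (e / 2 / (C + 1)); first by rewrite divr_gt0// ltr_wpDl.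
  by rewrite mulrAC ler_pdivrMr ?ltr_wpDl// ler_pM2l// lerDl.
have mV : 0 < m^-1 by rewrite invr_gt0.
(* [N] dominates every coefficient that multiplies [eps] in the bounds required of the two kinds of
   competitors. *)
pose N := 2 + M + (1 + m^-1) * 4.
have N0 : 0 < N by rewrite /N; lra.
pose eps := Num.min (Num.min T (del / 2)) (e / 2 / N).
have eps0 : 0 < eps by rewrite !lt_min T0 !divr_gt0.
have epsT : eps <= T by rewrite !ge_min lexx.
have epsdel : eps < del by rewrite !gt_min ltr_pdivrMr// ltr_pMr// ltr1n orbT.
have epsN : eps * N <= e / 2 by rewrite -ler_pdivlMr// !ge_min lexx !orbT.
have epsM : eps * M <= e / 2.
  by apply: le_trans epsN; rewrite ler_pM2l// /N; lra.
have eps2 : eps * 2 <= e / 2.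
  by apply: le_trans epsN; rewrite ler_pM2l// /N; lra.
have epsm : (1 + m^-1) * (4 / 3 * eps) <= e / 2.
  apply: le_trans epsN.
  rewrite [leLHS](_ : _ = eps * ((1 + m^-1) * (4 / 3))); last by ring.
  by rewrite ler_pM2l// /N; lra.
have [d d0 H] := braking_alternatives xv eps0.
exists (Num.min d (e / 2)); first by rewrite lt_min d0.
move=> X V XV; rewrite !lt_min => /andP[Xd Xe] /andP[Vd Ve].
case: (H X V XV Xd Vd) => [[k [theta /= [/andP[k0 kle] t0 Y1 Y2 [w1 w2]]]]|].
  move: kle; rewrite le_min => /andP[k1 ke].
  have kM : k * M <= eps * M by rewrite ler_wpM2r.
  apply: (mild_competitor etaM e0 t0 _ erefl Y1 Y2); [by rewrite k0|lra|lra|].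
  exists m => //; set q := _ ^+ 2 / theta in w2 *.
  have : (1 + m^-1) * (4 / 3 * q) <= (1 + m^-1) * (4 / 3 * eps).
    by rewrite ler_pM2l ?addr_gt0// ler_pM2l// divr_gt0.
  by lra.
move=> [v0 [theta [/andP[t0 te] Vt Vx]]].
have [X10 _ _] := (Xi_adE _ _).1 XV.
apply: (hard_competitor etaM _ _ v0 X10 Vt Vx).
- by rewrite t0/=; lra.
- by lra.
- move=> r s r0 rs sT srt; have := Hdel [:: (r, s)].
  rewrite !big_seq1/= andbT; apply => //; last by lra.
  by rewrite /ordered_in/= r0 rs sT.
- exact: ltW.
- by rewrite v0 subr0 in Ve; exact: ltW.
- by apply: le_trans epsM; rewrite ler_wpM2r.
Qed.

End fixed_curve.

Lemma finite_energy_curve T x v : 0 < T -> Xi_ad R (x, v) ->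
  exists xi eta C, Gamma_from T (x, v) (xi, eta) /\ energy_bound 0 T eta C.
Proof.
move=> T0 xv; have [theta t0 xt] := braking_exists xv.
have [/andP[x1 x0] _ _] := (Xi_adE _ _).1 xv.
(* The zero curve, entering with the weight [1 - 1 = 0], leaves only the braking curve from
   [(x, v)]. *)
have adm0 : admissible T (cst (0 : R)) (cst (0 : R)).
  move=> s _; split; first exact: derive_within_cst.
  by apply/XiE; rewrite lexx lerN10.
have E0 : energy_bound 0 T (cst (0 : R)) 0.
  by move=> n l r _; rewrite big1// => i _; rewrite subrr expr0n/= mul0r.
have k01 : 0 <= (1 : R) <= 1 by rewrite lexx ler01.
have E := energy_bound_combination v t0 (ltW T0) k01 ltr01 E0.
have A := @admissible_combination _ T theta 1 x v _ _ t0 k01 _ xt adm0.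
have {}A := A ltac:(by rewrite x1 x0).
have Eeq : (fun s => 1 * (cst 0 : R -> R) s + v * brake theta s ^+ 2) =
    (fun s => (1 - 1) * (cst 0 : R -> R) s + v * brake theta s ^+ 2).
  by apply/funext => s; rewrite subrr mul0r mulr0.
rewrite Eeq in E; do 3 eexists; split; last exact: E.
split; first exact: (energy_bound_Gamma T0 A E).
- by rewrite /= brake_pos0 subrr; ring.
- by rewrite /= brake0 subrr expr1n; ring.
Qed.

End competitor_existence.

(** * Passage to the limit *)

Section limit_curve.
Context {R : realType}.
Notation mu := (@lebesgue_measure R).
Implicit Types (T x v C e : R) (xi eta : R -> R).

Definition uniform_limit T (f_ : nat -> R -> R) (f : R -> R) :=
  forall e, 0 < e -> \forall i \near \oo, forall s, 0 <= s <= T -> `|f_ i s - f s| <= e.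

Lemma uniform_cvg_limit T (f_ : nat -> R -> R) (f : R -> R) :
  {uniform `[0, T]%classic, f_ @ \oo --> f} -> uniform_limit T f_ f.
Proof.
move=> cvf e e0.
pose P := [set h : R -> R | forall s, `[0, T]%classic s -> `|f s - h s| <= e].
have : nbhs (f : {uniform` `[0, T]%classic -> R}) P.
  apply/uniform_nbhs; exists [set p : R * R | `|p.1 - p.2| < e]; split.
    by exists e => //= -[a b].
  by move=> h H s sT; apply/ltW/H.
move=> nP; have nf : \forall i \near \oo, P (f_ i) := cvf _ nP.
apply: filterS nf => i H s sT; rewrite distrC; apply: H.
by rewrite /= in_itv.
Qed.

Lemma uniform_limit_continuous T (f_ : nat -> R -> R) (f : R -> R) :
  uniform_limit T f_ f -> (forall i, {within `[0, T], continuous (f_ i)}) ->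
  {within `[0, T], continuous f}.
Proof.
move=> lf cf_; apply/within_continuousP => s s01 e e0.
have sT : 0 <= s <= T by move: s01; rewrite /= in_itv.
have e3 : 0 < e / 3 by rewrite divr_gt0.
have [i Hi] := filter_ex (lf _ e3).
have /within_continuousP/(_ s s01 _ e3)[d d0 H] := cf_ i.
exists d => // y y01 yd.
have yT : 0 <= y <= T by move: y01; rewrite /= in_itv.
have := H y y01 yd; have := Hi s sT; have := Hi y yT.
rewrite !ler_norml => /andP[? ?] /andP[? ?] /andP[? ?].
by apply/andP; split; lra.
Qed.

(** The difference quotient of [xi_ i] is a value [eta_ i c] with [c] between [s] and [y], close to
    [eta s] by uniform convergence and continuity of [eta]. *)
Lemma uniform_limit_admissible T (xi_ eta_ : nat -> R -> R) xi eta :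
  uniform_limit T xi_ xi -> uniform_limit T eta_ eta ->
  (forall i, {within `[0, T], continuous (eta_ i)}) ->
  (forall i, admissible T (xi_ i) (eta_ i)) -> admissible T xi eta.
Proof.
move=> lxi leta ceta_ adm_ s s01.
have sT : 0 <= s <= T by move: s01; rewrite in_itv.
have /within_continuousP ceta := uniform_limit_continuous leta ceta_.
split; last first.
  apply/XiE; apply/andP; split; apply/ler_addgt0Pr => e e0;
    have [i Hi] := filter_ex (lxi _ e0); have [_ /XiE/andP[? ?]] := adm_ i s s01;
    have := Hi s sT; rewrite ler_norml => /andP[? ?]; lra.
apply/derive_withinP => e e0; have e2 : 0 < e / 2 by rewrite divr_gt0.
have [d d0 Hd] := ceta s s01 _ e2.
exists d => // y y01 yd.
have yT : 0 <= y <= T by move: y01; rewrite /= in_itv.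
have [->|ys] := eqVneq y s; first by rewrite !subrr mulr0 subrr normr0 mulr0.
have u0 : 0 < `|y - s| by rewrite normr_gt0 subr_eq0.
set u := `|y - s| in u0 yd *.
(* The index [i] may depend on [y]. Two errors [r] from [xi_ i] and [(r + e / 2) * u] from the
   velocity sum to [e * u] for this value of [r]. *)
have r0 : 0 < e / 2 * u / (2 + u) by rewrite divr_gt0 ?mulr_gt0// addr_gt0.
set r := e / 2 * u / (2 + u) in r0.
have rE : r * (2 + u) = e / 2 * u by rewrite /r divfK// gt_eqF// addr_gt0.
have [i [Hx He]] := filter_ex (filterI (lxi _ r0) (leta _ r0)).
have [c [cT cs E]] := derive_within_MVT_sym (fun s sT => (adm_ i s sT).1) sT yT.
have c01 : `[0, T]%classic c by rewrite /= in_itv.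
have B1 : `|eta_ i c - eta s| <= r + e / 2.
  rewrite -(subrK (eta c) (eta_ i c)) -addrA; apply: le_trans (ler_normD _ _) _.
  by rewrite lerD ?He// Hd// (le_lt_trans cs).
rewrite (_ : _ - _ = (eta_ i c - eta s) * (y - s) + (xi y - xi_ i y) - (xi s - xi_ i s)).
  apply: le_trans (ler_normB _ _) _.
  have N1 := Hx s sT; rewrite distrC in N1.
  apply: le_trans (lerD (ler_normD _ _) N1) _.
  have N2 := Hx y yT; rewrite distrC in N2.
  have N3 : `|(eta_ i c - eta s) * (y - s)| <= (r + e / 2) * u.
    by rewrite normrM ler_wpM2r.
  by have := lerD N3 N2; lra.
by rewrite mulrBl -E; ring.
Qed.

(** * Closedness of the graph of optimal curves *)

Section closedness.
Variables (T : R) (ell : R * R * R -> R) (g : R * R -> R).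
Hypotheses (T_gt0 : 0 < T)
  (ell_cont : {within Xi R `*` `[0, T]%classic, continuous ell})
  (g_cont : {within Xi R, continuous g}).
Variables (x_ v_ : nat -> R) (x v : R) (xi_ eta_ : nat -> R -> R) (xi eta : R -> R).
Hypotheses (xv_ad_ : forall i, Xi_ad R (x_ i, v_ i))
  (xv_cvg : (x_ i, v_ i) @[i --> \oo] --> (x, v))
  (xv_ad : Xi_ad R (x, v))
  (opt_ : forall i, Gamma_opt T ell g (x_ i, v_ i) (xi_ i, eta_ i))
  (xi_lim : uniform_limit T xi_ xi)
  (eta_lim : uniform_limit T eta_ eta).

Let total_cost c : R :=
  running_cost T ell c.1 c.2 + g (c.1 T, c.2 T).

Let Gamma_ i : Gamma T (xi_ i, eta_ i).
Proof. by have [[]] := opt_ i. Qed.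

Let eta_cont_ i : {within `[0, T], continuous (eta_ i)}.
Proof. by have [] := Gamma_continuous T_gt0 (Gamma_ i). Qed.

Let admissible_xi : admissible T xi eta.
Proof.
apply: (uniform_limit_admissible xi_lim eta_lim eta_cont_) => i.
by have [_ _] := Gamma_ i.
Qed.

Let eta_cont : {within `[0, T], continuous eta}.
Proof. exact: uniform_limit_continuous eta_lim eta_cont_. Qed.

Let xi_cont : {within `[0, T], continuous xi}.
Proof.
apply: (@derive_within_continuous _ _ _ eta) => s sT.
by have [] := admissible_xi sT.
Qed.

Let xi_strip : in_strip T xi.
Proof.
move=> s sT; apply/(XiE _ (eta s)).
by have [|_] := @admissible_xi s; first by rewrite in_itv.
Qed.

Let start_near e : 0 < e -> \forall i \near \oo, `|x_ i - x| < e /\ `|v_ i - v| < e.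
Proof.
move=> e0.
have nb : \forall i \near \oo, ball (x, v) e (x_ i, v_ i) :=
  xv_cvg (nbhsx_ballx (x, v) e e0).
by apply: filterS nb => i [/=]; rewrite /ball /= distrC => xd; rewrite distrC.
Qed.

Let xi0 : xi 0 = x /\ eta 0 = v.
Proof.
have T01 : 0 <= (0 : R) <= T by rewrite lexx ltW.
split; apply/eqP; rewrite -subr_eq0 -normr_le0; apply/ler_addgt0Pr => e e0;
  have e2 : 0 < e / 2 by rewrite divr_gt0//.
- have [i [Hi [Hx _]]] := filter_ex (filterI (xi_lim e2) (start_near e2)).
  have [[_ /= xi_0 _] _] := opt_ i; have := Hi 0 T01; rewrite xi_0 distrC => ?.
  rewrite add0r -(subrK (x_ i) (xi 0)) -addrA; apply: le_trans (ler_normD _ _) _; lra.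
- have [i [Hi [_ Hv]]] := filter_ex (filterI (eta_lim e2) (start_near e2)).
  have [[_ /= _ eta_0] _] := opt_ i; have := Hi 0 T01; rewrite eta_0 distrC => ?.
  rewrite add0r -(subrK (v_ i) (eta 0)) -addrA; apply: le_trans (ler_normD _ _) _; lra.
Qed.

(** Indices 1 to 4 stand for the optimal curve, its competitor, the comparison curve and the limit
    curve. Doubling the cost inequality yields eight errors [r], and [m] is the ninth. *)
Let cost_gap (E1 E2 L1 L2 L3 L4 G1 G2 G3 G4 C K m r e : R) :
  L1 + 2^-1 * E1 + G1 <= L2 + 2^-1 * E2 + G2 -> E2 <= C + m + K ->
  `|L2 - L3| <= r -> `|G2 - G3| <= r -> `|L1 - L4| <= r -> `|G1 - G4| <= r ->
  m <= r -> 9 * r = e ->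
  E1 - K <= C + 2 * ((L3 + G3) - (L4 + G4)) + e.
Proof.
rewrite !ler_norml => ? ? /andP[? ?] /andP[? ?] /andP[? ?] /andP[? ?] ? ?; lra.
Qed.

Let cost_le (E E' L L' G G' : R) : E <= E' + 2 * ((L' + G') - (L + G)) ->
  L + 2^-1 * E + G <= L' + 2^-1 * E' + G'.
Proof. by lra. Qed.

(** Optimality of the limit, stated as an energy bound: it makes sense before [eta] is known to be
    absolutely continuous. The optimal curves are compared with competitors near [(xi', eta')], and
    [K] cancels. *)
Lemma limit_energy_bound xi' eta' C : Gamma_from T (x, v) (xi', eta') ->
  energy_bound 0 T eta' C ->
  energy_bound 0 T eta (C + 2 * (total_cost (xi', eta') - total_cost (xi, eta))).
Proof.
move=> xieta' etaC; have [G' _ _] := xieta'.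
have [cxi' ceta'] := Gamma_continuous T_gt0 G'.
apply: (@energy_bound_limit _ T _ eta_).
- by apply/clamp_continuous_within => //; exact: ltW.
- exact: eta_lim.
move=> e e0; pose r := e / 9.
have r0 : 0 < r by rewrite divr_gt0.
have rE : 9 * r = e by rewrite /r mulrC divfK.
have re : r <= e by rewrite /r ler_pdivrMr// ler_peMr ?ltW// ltr1n.
have mr d : Num.min r d <= r by rewrite ge_min lexx.
have [d1 d10 H1] := running_cost_close T_gt0 ell_cont g_cont cxi' ceta'
  (Gamma_in_strip G') r0.
have [d2 d20 H2] := running_cost_close T_gt0 ell_cont g_cont xi_cont eta_cont
  xi_strip r0.
have m0 : 0 < Num.min r d1 by rewrite lt_min r0.
have [d3 d30 H3] := nearby_competitor_exists T_gt0 xieta' etaC xv_ad m0.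
near=> i.
have [[/= xid vid] [Hxi Heta]] : (`|x_ i - x| < d3 /\ `|v_ i - v| < d3) /\
    ((forall s, 0 <= s <= T -> `|xi_ i s - xi s| <= d2) /\
     (forall s, 0 <= s <= T -> `|eta_ i s - eta s| <= d2)).
  by split; [near: i; exact: start_near|split; near: i; [exact: xi_lim|exact: eta_lim]].
have [xic [etac [theta [K [Gc close Ec [/andP[t0 te] tT] after]]]]] :=
  H3 _ _ (xv_ad_ i) xid vid.
have [Gc' _ _] := Gc; have [cxic cetac] := Gamma_continuous T_gt0 Gc'.
have [E2c Ecle] := energy_bound_derive1 T_gt0 Ec.
have [G_i opt_i] := opt_ i.
have le_cost := opt_i _ Gc.
(* Otherwise the optimal cost would be infinite, whereas the competitor has finite cost. *)
have E2_i : mu.-integrable `[0, T] (EFin \o (fun s => derive1 (eta_ i) s ^+ 2)).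
  apply: contrapT => nE2; move: le_cost.
  by rewrite (cost_pinfty _ _ T_gt0 (Gamma_ i) nE2) (costE _ T_gt0 ell_cont Gc' E2c).
move: le_cost; rewrite (costE _ T_gt0 ell_cont Gc' E2c).
rewrite (costE _ T_gt0 ell_cont (Gamma_ i) E2_i) lee_fin /= => le_cost.
exists theta; split => //.
  by rewrite t0 (le_trans te)// (le_trans (mr _)).
apply: energy_bound_le (after _ G_i E2_i) => /=.
have md1 : Num.min r d1 <= d1 by rewrite ge_min lexx orbT.
have [R1 S1] : `|running_cost T ell xic etac - running_cost T ell xi' eta'| <= r /\
    `|g (xic T, etac T) - g (xi' T, eta' T)| <= r.
  apply: H1 => // [|s sT]; first exact: Gamma_in_strip Gc'.
  by have [C1 C2] := close s sT; split; exact: le_trans md1.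
have [R2 S2] : `|running_cost T ell (xi_ i) (eta_ i) - running_cost T ell xi eta| <= r /\
    `|g (xi_ i T, eta_ i T) - g (xi T, eta T)| <= r.
  apply: H2.
  - by have [] := Gamma_continuous T_gt0 (Gamma_ i).
  - exact: eta_cont_.
  - exact: Gamma_in_strip (Gamma_ i).
  - by move=> s sT; split; [exact: Hxi|exact: Heta].
exact: cost_gap le_cost Ecle R1 S1 R2 S2 (mr d1) rE.
Unshelve. all: by end_near. Qed.

Lemma limit_optimal : Gamma_opt T ell g (x, v) (xi, eta).
Proof.
(* Comparison with one curve of finite energy shows that the limit has finite energy and belongs to
   [Gamma]; only then can its cost be computed. *)
have [xi' [eta' [C [G' E']]]] := finite_energy_curve T_gt0 xv_ad.
have E := limit_energy_bound G' E'.
have G : Gamma T (xi, eta) := energy_bound_Gamma T_gt0 admissible_xi E.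
have [E2 _] := energy_bound_derive1 T_gt0 E.
split; first by have [? ?] := xi0.
move=> [xi1 eta1] G1; have [G1' _ _] := G1.
have [E21|nE21] := pselect (mu.-integrable `[0, T]
    (EFin \o (fun s => derive1 eta1 s ^+ 2))); last first.
  by rewrite (cost_pinfty _ _ T_gt0 G1' nE21) leey.
have [_ ac1 _] := G1'.
(* With [C] the exact energy of the comparison curve, [limit_energy_bound] becomes the inequality
   between the costs. *)
have B := abs_continuous_energy_bound (ltW T_gt0) ac1 E21.
have [_] := energy_bound_derive1 T_gt0 (limit_energy_bound G1 B).
rewrite (costE _ T_gt0 ell_cont G E2) (costE _ T_gt0 ell_cont G1' E21) lee_fin.
exact: cost_le.
Qed.

End closedness.
End limit_curve.

Theorem theorem4p1 (R : realType) (T : R) (T_gt0 : 0 < T)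
    (ell : R * R * R -> R) (g : R * R -> R)
    (ell_cont : {within Xi R `*` `[0, T]%classic, continuous ell})
    (g_cont : {within Xi R, continuous g})
    (ell_lb : has_lbound (ell @` (Xi R `*` `[0, T]%classic)))
    (g_lb : has_lbound (g @` Xi R))
    (ell_bd : forall t v : R, t \in `[0, T] -> 0 < v ->
       ell (0, 0, t) <= ell (0, v, t) /\ ell (-1, 0, t) <= ell (-1, - v, t))
    (x_ v_ : nat -> R) (x v : R)
    (xv_ad_ : forall i, Xi_ad R (x_ i, v_ i))
    (xv_cvg : (x_ i, v_ i) @[i --> \oo] --> (x, v))
    (xv_ad : Xi_ad R (x, v))
    (xi_ eta_ : nat -> R -> R) (xi eta : R -> R)
    (opt_ : forall i, Gamma_opt T ell g (x_ i, v_ i) (xi_ i, eta_ i))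
    (xi_cvg : {uniform `[0, T]%classic, xi_ @ \oo --> xi})
    (eta_cvg : {uniform `[0, T]%classic, eta_ @ \oo --> eta}) :
  Gamma_opt T ell g (x, v) (xi, eta).
Proof.
exact: (limit_optimal T_gt0 ell_cont g_cont xv_ad_ xv_cvg xv_ad opt_
  (uniform_cvg_limit xi_cvg) (uniform_cvg_limit eta_cvg)).
Qed.
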